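(* Let $A$ be an $N \times n$ random matrix whose rows $A_1,\dots,A_N$ are independent sub-gaussian isotropic random vectors in $\mathbb{R}^n$. Then for every $t \ge 0$, with probability at least $1 - 2\exp(-ct^2)$ one has $$\sqrt{N} - C\sqrt{n} - t \le s_{\min}(A) \le s_{\max}(A) \le \sqrt{N} + C\sqrt{n} + t.$$ Here $C = C_K > 0$ and $c = c_K > 0$ depend only on the sub-gaussian norm $K = \max_i \|A_i\|_{\psi_2}$ of the rows.
   Context: All matrices are real. For an $N \times n$ matrix $A$, the singular values $s_1(A) \ge \dots \ge s_n(A) \ge 0$ are the eigenvalues of $\sqrt{A^*A}$; $s_{\max}(A) = s_1(A)$ and $s_{\min}(A) = s_n(A)$ (so $s_{\min}(A)=0$ if $N<n$). A random vector $X$ in $\mathbb{R}^n$ is isotropic if $\mathbb{E}\, XX^T = I$, equivalently $\mathbb{E}\langle X,x\rangle^2 = \|x\|_2^2$ for all $x \in \mathbb{R}^n$ (no centering is assumed). The sub-gaussian norm of a random variable $Z$ is $\|Z\|_{\psi_2} = \sup_{p \ge 1} p^{-1/2} (\mathbb{E}|Z|^p)^{1/p}$, and $Z$ is sub-gaussian if this is finite. A random vector $X$ in $\mathbb{R}^n$ is sub-gaussian if $\langle X,x\rangle$ is sub-gaussian for every $x\in\mathbb{R}^n$, and $\|X\|_{\psi_2} = \sup_{x \in S^{n-1}} \|\langle X,x\rangle\|_{\psi_2}$, where $S^{n-1}$ is the unit Euclidean sphere. *)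

(* Defs.v *)
From mathcomp Require Import all_boot all_order all_algebra.
From mathcomp Require Import all_classical all_reals all_analysis.
From mathcomp Require Import polyrcf.

Set Implicit Arguments.
Unset Strict Implicit.
Unset Printing Implicit Defensive.

Import Order.TTheory GRing.Theory Num.Theory.
Import numFieldNormedType.Exports.

Local Open Scope classical_set_scope.
Local Open Scope ring_scope.

Section SingularValues.
Context {R : realType}.

Definition is_psd n (M : 'M[R]_n) : Prop :=
  M^T = M /\ forall x : 'rV[R]_n, 0 <= (x *m M *m x^T) 0 0.

(* For M positive semidefinite there is exactly one such B; 0 is a junk value
   for the other matrices M. *)
Definition sqrtmx n (M : 'M[R]_n) : 'M[R]_n :=
  xget 0 [set B : 'M[R]_n | is_psd B /\ B *m B = M].

(* Nonincreasing, each eigenvalue repeated according to its multiplicity as a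
   root of the characteristic polynomial. *)
Definition eigenvalues n (M : 'M[R]_n) : seq R :=
  sort >=%R
    (flatten [seq nseq (mup x (char_poly M)) x | x <- rootsR (char_poly M)]).

Definition singular_values N n (A : 'M[R]_(N, n)) : seq R :=
  eigenvalues (sqrtmx (A^T *m A)).

(* The list is indexed from 0: s_1(A) has index 0 and s_n(A) has index n.-1. *)
Definition smax N n (A : 'M[R]_(N, n)) : R := (singular_values A)`_0.

Definition smin N n (A : 'M[R]_(N, n)) : R := (singular_values A)`_n.-1.

End SingularValues.

Section RandomVectors.
Context {d : measure_display} {T : measurableType d} {R : realType}.
Variable P : probability T R.

Definition dotv n (u v : 'rV[R]_n) : R := \sum_(j < n) u 0 j * v 0 j.

(* The library norm on row vectors is the sup norm, hence this definition. *)
Definition norm2 n (x : 'rV[R]_n) : R := Num.sqrt (dotv x x).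

Definition borel n : set (set 'rV[R]_n) := <<s @open 'rV[R]_n >>.

Definition random_vector n (X : T -> 'rV[R]_n) : Prop :=
  forall B, borel B -> measurable (X @^-1` B).

(* The product rule for subfamilies is the case B i = setT for the others. *)
Definition independent_vectors N n (X : 'I_N -> T -> 'rV[R]_n) : Prop :=
  forall B : 'I_N -> set 'rV[R]_n, (forall i, borel (B i)) ->
    P [set w | forall i, B i (X i w)] =
    (\prod_(i < N) P (X i @^-1` B i))%E.

(* Vectors are rows, so X^T *m X is the matrix written X X^T for columns. *)
Definition isotropic n (X : T -> 'rV[R]_n) : Prop :=
  forall j k : 'I_n,
    ('E_P[fun w => ((X w)^T *m X w)%R j k] = ((1%:M : 'M[R]_n) j k)%:E)%E.

Definition psi2_norm (Z : T -> R) : \bar R :=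
  ereal_sup [set ((p `^ (- 2^-1))%:E * 'N[P]_(p%:E)[EFin \o Z])%E
            | p in [set p : R | 1 <= p]].

Definition sub_gaussian (Z : T -> R) : Prop := (psi2_norm Z < +oo)%E.

Definition sub_gaussian_vector n (X : T -> 'rV[R]_n) : Prop :=
  forall x : 'rV[R]_n, sub_gaussian (fun w => dotv (X w) x).

Definition psi2_norm_vector n (X : T -> 'rV[R]_n) : \bar R :=
  ereal_sup [set psi2_norm (fun w => dotv (X w) x)
            | x in [set x : 'rV[R]_n | norm2 x = 1]].

End RandomVectors.

(* Main.v *)
Require Import Defs.
From mathcomp Require Import all_boot all_order all_algebra.
From mathcomp Require Import all_classical all_reals all_analysis.
From mathcomp Require Import measurable_realfun polyrcf ring lra.
From mathcomp Require complex.

(* By the spectral theorem s_min(A) and s_max(A) are the extreme values of |Ax|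
   on the unit sphere, so it suffices that A^T A - N I has quadratic form at
   most eps N on the sphere, where eps = max(delta, delta^2) and
   delta = (C sqrt n + t) / sqrt N.  A net of at most g^n points of the grid
   (8 sqrt n)^-1 Z^n reduces this, up to a factor 2, to single vectors y.  For
   fixed y the form is N |y|^2 times the deviation from 1 of the mean of the
   independent sub-exponential variables <A_i, y/|y|>^2, and the Chernoff bound
   gives probability at most 2 exp(- c (C^2 n + t^2)); the choice
   C^2 c = ln g absorbs the union bound over the net. *)

Set Implicit Arguments.
Unset Strict Implicit.
Unset Printing Implicit Defensive.

Import Order.TTheory GRing.Theory Num.Theory.
Import numFieldNormedType.Exports.

Local Open Scope classical_set_scope.
Local Open Scope ring_scope.

(** Besides the estimate there is a measurability obstacle: [smin] and [smax] come from a chosen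
    square root and a sorted list of polynomial roots, while passing to the complement needs a
    measurable event. The event is therefore rewritten as countably many quadratic inequalities, one
    for each rational vector. Net points are rounded towards 0, so they lie in the unit ball but not
    on the sphere; hence deviations are measured relative to [dotv y y]. A bound on the l1 norm of
    their integer coordinates keeps their number exponential in n. Isotropy gives each squared
    projection mean exactly 1 on the sphere. This cancels the linear term of the exponential moment
    and leaves an error quadratic in the Chernoff parameter. *)

Section DotProduct.
Context {R : realType}.

Lemma dotvE n (u v : 'rV[R]_n) : dotv u v = (u *m v^T) 0 0.
Proof. by rewrite mxE; apply: eq_bigr => j _; rewrite mxE. Qed.

Lemma dotvC n (u v : 'rV[R]_n) : dotv u v = dotv v u.
Proof. by apply: eq_bigr => j _; rewrite mulrC. Qed.

Lemma dotvDl n (u v w : 'rV[R]_n) : dotv (u + v) w = dotv u w + dotv v w.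
Proof. by rewrite !dotvE mulmxDl mxE. Qed.

Lemma dotvZl n a (u v : 'rV[R]_n) : dotv (a *: u) v = a * dotv u v.
Proof. by rewrite !dotvE -scalemxAl mxE. Qed.

Lemma dotvNl n (u v : 'rV[R]_n) : dotv (- u) v = - dotv u v.
Proof. by rewrite -scaleN1r dotvZl mulN1r. Qed.

Lemma dotvDr n (u v w : 'rV[R]_n) : dotv w (u + v) = dotv w u + dotv w v.
Proof. by rewrite !(dotvC w) dotvDl. Qed.

Lemma dotvZr n a (u v : 'rV[R]_n) : dotv u (a *: v) = a * dotv u v.
Proof. by rewrite !(dotvC u) dotvZl. Qed.

Lemma dotvNr n (u v : 'rV[R]_n) : dotv u (- v) = - dotv u v.
Proof. by rewrite !(dotvC u) dotvNl. Qed.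

Lemma dotvv_ge0 n (u : 'rV[R]_n) : 0 <= dotv u u.
Proof. by apply: sumr_ge0 => j _; rewrite -expr2 sqr_ge0. Qed.

Lemma dotvv_eq0 n (u : 'rV[R]_n) : (dotv u u == 0) = (u == 0).
Proof.
apply/eqP/eqP => [u0|->]; last first.
  by apply: big1 => j _; rewrite mxE mul0r.
apply/rowP => j; rewrite mxE; apply/eqP; rewrite -sqrf_eq0 expr2.
by move/eqP: u0; rewrite psumr_eq0 => [/allP/(_ j (mem_index_enum _))|i _];
  rewrite -?expr2 ?sqr_ge0.
Qed.

Lemma dotvv_gt0 n (u : 'rV[R]_n) : (0 < dotv u u) = (u != 0).
Proof. by rewrite lt0r dotvv_ge0 dotvv_eq0 andbT. Qed.

Lemma norm2_eq1 n (u : 'rV[R]_n) : norm2 u = 1 <-> dotv u u = 1.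
Proof.
split=> [u1|]; last by rewrite /norm2 => ->; rewrite sqrtr1.
by rewrite -[LHS]sqr_sqrtr ?dotvv_ge0// -/(norm2 u) u1 expr1n.
Qed.

Lemma dotv_mull m n (u : 'rV[R]_m) (v : 'rV[R]_n) (M : 'M[R]_(m, n)) :
  dotv (u *m M) v = dotv u (v *m M^T).
Proof. by rewrite !dotvE trmx_mul trmxK mulmxA. Qed.

End DotProduct.

(** * Spectral theorem for real symmetric matrices *)

Section Spectral.
Import complex.
Context {R : realType}.

(* The complex eigenvalue is real because the matrix is symmetric, so the real
   and imaginary parts of a complex eigenvector are real eigenvectors. *)
Lemma symmetric_eigenvector n (M : 'M[R]_n) : (0 < n)%N -> M^T = M ->
  exists (a : R) (v : 'rV[R]_n), dotv v v = 1 /\ v *m M = a *: v.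
Proof.
move=> n0 Msym.
pose Mc : 'M[complex R]_n := map_mx (real_complex R) M.
have [ac /eigenvalueP[vc vcM vc0]] := @eigenvalue_closed (complex R) n Mc n0.
pose x : 'rV[R]_n := map_mx (@Re R) vc.
pose y : 'rV[R]_n := map_mx (@Im R) vc.
pose b := Re ac; pose c := Im ac.
have vcE j : vc 0 j = (x 0 j +i* y 0 j)%C by rewrite !mxE; case: (vc 0 j).
have acE : ac = (b +i* c)%C by rewrite /b /c; case: (ac).
have xyM j : (vc *m Mc) 0 j = ((x *m M)%R 0%R j +i* (y *m M)%R 0%R j)%C.
  rewrite !mxE; apply/eqP; rewrite eq_complex !raddf_sum/=.
  by apply/andP; split; apply/eqP; apply: eq_bigr => i _;
    rewrite vcE !mxE/= !mulr0 ?subr0 ?add0r.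
have {}vcM j : (x *m M) 0 j = b * x 0 j - c * y 0 j /\
               (y *m M) 0 j = b * y 0 j + c * x 0 j.
  have := xyM j; rewrite vcM [LHS]mxE vcE acE => /eqP; rewrite eq_sym.
  by rewrite eq_complex => /andP[/eqP/= -> /eqP/= ->].
have xM : x *m M = b *: x - c *: y.
  by apply/rowP => j; rewrite (vcM j).1 !mxE.
have yM : y *m M = b *: y + c *: x.
  by apply/rowP => j; rewrite (vcM j).2 !mxE.
have xy0 : x != 0 \/ y != 0.
  apply/orP; rewrite -negb_and; apply: contra vc0 => /andP[/eqP x0 /eqP y0].
  by apply/eqP/rowP => j; rewrite vcE x0 y0 !mxE.
have c0 : c = 0.
  have : dotv (x *m M) y = dotv x (y *m M) by rewrite dotv_mull Msym.
  rewrite xM yM dotvDl dotvNl !dotvZl dotvDr !dotvZr => cE.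
  have /eqP : c * (dotv x x + dotv y y) = 0 by lra.
  rewrite mulf_eq0 paddr_eq0 ?dotvv_ge0// !dotvv_eq0 => /orP[/eqP//|].
  by case: xy0 => /negPf ->; rewrite ?andbF.
have normalize (u : 'rV[R]_n) : u != 0 -> u *m M = b *: u ->
    exists (a : R) (v : 'rV[R]_n), dotv v v = 1 /\ v *m M = a *: v.
  rewrite -dotvv_gt0 => u0 uM.
  exists b, ((Num.sqrt (dotv u u))^-1 *: u); split; last first.
    by rewrite -scalemxAl uM !scalerA mulrC.
  rewrite dotvZl dotvZr mulrA -invfM -expr2 sqr_sqrtr ?ltW// mulVf//.
  by rewrite gt_eqF.
move: xM yM; rewrite c0 !scale0r subr0 addr0 => xM yM.
by case: xy0 => ?; [apply: (normalize x)|apply: (normalize y)].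
Qed.

(** The reflection in the hyperplane orthogonal to [v - e] exchanges the unit vectors [v] and [e],
    and so completes [v] to an orthonormal basis. It degenerates when [v = e], where the identity
    serves. *)
Lemma householder n (v : 'rV[R]_n.+1) : dotv v v = 1 ->
  exists H : 'M[R]_n.+1, H *m H^T = 1%:M /\ row 0 H = v.
Proof.
move=> v1; pose e : 'rV[R]_n.+1 := delta_mx 0 0.
have eM (H : 'M[R]_n.+1) : row 0 H = e *m H by rewrite rowE.
have [ve|ve] := eqVneq v e.
  by exists 1%:M; rewrite trmx1 mulmx1 eM mulmx1.
have ee : dotv e e = 1.
  rewrite /dotv (bigD1 0)//= big1 ?mxE ?eqxx ?mulr1 ?addr0// => j j0.
  by rewrite mxE (negPf j0) andbF mul0r.
have [w wE] : exists w, w = v - e by exists (v - e).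
pose s := dotv w w.
have s0 : s != 0 by rewrite dotvv_eq0 wE subr_eq0.
have sE : s = 2 - 2 * dotv e v.
  rewrite /s wE dotvDl !dotvDr !dotvNl !dotvNr v1 ee (dotvC v e) opprK; ring.
pose H : 'M[R]_n.+1 := 1%:M - (2 / s) *: (w^T *m w).
have ww : w *m w^T = s%:M by rewrite [LHS]mx11_scalar -dotvE.
exists H; split.
  have -> : H^T = H.
    by rewrite /H raddfB/= linearZ/= trmx1 trmx_mul trmxK.
  have : w^T *m w *m (w^T *m w) = s *: (w^T *m w).
    by rewrite mulmxA -[w^T *m w *m w^T]mulmxA ww mul_mx_scalar -scalemxAl.
  rewrite /H; move: (w^T *m w) => S SS.
  rewrite mulmxBl mul1mx mulmxBr mulmx1 -scalemxAl -scalemxAr SS.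
  by apply/matrixP => i j; rewrite !mxE; field.
have ew : e *m w^T = (dotv e w)%:M by rewrite [LHS]mx11_scalar -dotvE.
rewrite eM /H mulmxBr mulmx1 -scalemxAr mulmxA ew mul_scalar_mx scalerA.
have -> : 2 / s * dotv e w = - 1.
  have -> : dotv e w = - s / 2 by rewrite sE wE dotvDr dotvNr ee; field.
  by field.
by rewrite scaleN1r opprK wE addrC subrK.
Qed.

(** Deflation: in an orthonormal basis starting with an eigenvector the first row of the matrix is a
    multiple of [delta_mx 0 0], so by symmetry the matrix is block diagonal and induction applies to
    the lower block. *)
Lemma symmetric_spectral n (M : 'M[R]_n) : M^T = M ->
  exists (Q : 'M[R]_n) (D : 'rV[R]_n),
    Q *m Q^T = 1%:M /\ M = Q^T *m diag_mx D *m Q.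
Proof.
elim: n M => [|n IH] M Msym.
  by exists 1%:M, 0; rewrite trmx1 mulmx1 !thinmx0.
have [a [v [v1 vM]]] := symmetric_eigenvector (ltn0Sn n) Msym.
have [H [HH Hv]] := householder v1.
have HTH : H^T *m H = 1%:M by apply: mulmx1C.
pose M' : 'M[R]_(1 + n) := H *m M *m H^T.
have M'sym : M'^T = M' by rewrite /M' !trmx_mul trmxK Msym mulmxA.
have M'0 : row 0 M' = a *: delta_mx 0 0.
  rewrite /M' !row_mul Hv vM -scalemxAl -Hv -row_mul HH.
  by rewrite rowE mulmx1.
have M'urE : ursubmx M' = 0.
  apply/matrixP => i j; rewrite ord1 !mxE.
  have /rowP/(_ (rshift 1 j)) := M'0; rewrite !mxE.
  have -> : lshift n (0 : 'I_1) = 0 :> 'I_n.+1 by apply: val_inj.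
  by move=> ->; rewrite eqxx/= mulr0.
have M'ulE : ulsubmx M' = a%:M.
  apply/matrixP => i j; rewrite !ord1 !mxE.
  have /rowP/(_ (lshift n 0)) := M'0; rewrite !mxE.
  have -> : lshift n (0 : 'I_1) = 0 :> 'I_n.+1 by apply: val_inj.
  by move=> ->; rewrite eqxx/= mulr1.
have M'dlE : dlsubmx M' = 0 by rewrite -M'sym -trmx_ursub M'urE trmx0.
have Bsym : (drsubmx M')^T = drsubmx M' by rewrite trmx_drsub M'sym.
have [Q [D [QQ BE]]] := IH _ Bsym.
have QTQ : Q^T *m Q = 1%:M by apply: mulmx1C.
pose Q1 : 'M[R]_(1 + n) := block_mx 1%:M 0 0 Q.
have M'E : M' = Q1^T *m diag_mx (row_mx a%:M D) *m Q1.
  rewrite -[LHS]submxK M'urE M'ulE M'dlE BE /Q1 tr_block_mx !trmx0 trmx1.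
  rewrite diag_mx_row !mulmx_block !mulmx0 !mul0mx !addr0 !add0r mul1mx mulmx1.
  congr block_mx; rewrite ?mul0mx// ?mulmxA//; apply/matrixP => i j.
  by rewrite !ord1 !mxE eqxx.
have Q1Q1 : Q1 *m Q1^T = 1%:M.
  rewrite /Q1 tr_block_mx !trmx0 trmx1 mulmx_block !mulmx0 !mul0mx !addr0.
  by rewrite !add0r mul1mx QQ -scalar_mx_block.
exists (Q1 *m H), (row_mx a%:M D); split.
  by rewrite trmx_mul -mulmxA (mulmxA H) HH mul1mx.
have -> : M = H^T *m M' *m H.
  by rewrite /M' !mulmxA HTH mul1mx -mulmxA HTH mulmx1.
by rewrite M'E trmx_mul !mulmxA.
Qed.

End Spectral.

(** * Singular values as extreme values on the sphere *)

Section SingularValueBounds.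
Context {R : realType}.

Lemma mup_prod_XsubC (x : R) (s : seq R) :
  mup x (\prod_(a <- s) ('X - a%:P)) = count_mem x s.
Proof.
elim: s => [|a s IH]; first by rewrite big_nil mupNroot// root1.
rewrite big_cons mupM ?polyXsubC_eq0//; last first.
  by rewrite monic_neq0// monic_prod_XsubC.
by rewrite IH -['X - a%:P]expr1 mup_XsubCX /= eq_sym; case: eqP.
Qed.

Lemma char_poly_orthoconj n (Q B : 'M[R]_n) : Q *m Q^T = 1%:M ->
  char_poly (Q^T *m B *m Q) = char_poly B.
Proof.
move=> QQ; have QTQ : Q^T *m Q = 1%:M by apply: mulmx1C.
rewrite /char_poly; pose q := map_mx (@polyC R) Q.
have qTq : q^T *m q = 1%:M by rewrite /q map_trmx -map_mxM QTQ map_mx1.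
have -> : char_poly_mx (Q^T *m B *m Q) = q^T *m char_poly_mx B *m q.
  rewrite /char_poly_mx mulmxBr mulmxBl mul_mx_scalar -scalemxAl qTq.
  by rewrite scalemx1 !map_mxM /q map_trmx.
by rewrite !det_mulmx mulrAC -det_mulmx qTq det1 mul1r.
Qed.

(** [rootsR] lists each root once, and its multiplicity is its number of occurrences on the
    diagonal. The flattened list is thus a permutation of the diagonal, and sorting forgets the
    order. *)
Lemma eigenvalues_diag n (Q : 'M[R]_n) (D : 'rV[R]_n) : Q *m Q^T = 1%:M ->
  eigenvalues (Q^T *m diag_mx D *m Q) = sort >=%R [seq D 0 i | i <- enum 'I_n].
Proof.
move=> QQ; rewrite /eigenvalues char_poly_orthoconj//.
set s := [seq D 0 i | i <- enum 'I_n].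
have -> : char_poly (diag_mx D) = \prod_(a <- s) ('X - a%:P).
  rewrite char_poly_trig ?diag_mx_is_trig// big_map big_enum/=.
  by apply: eq_bigr => i _; rewrite mxE eqxx.
set p := \prod_(_ <- _) _.
have p0 : p != 0 by rewrite monic_neq0// monic_prod_XsubC.
apply/perm_sortP; [exact: ge_total|exact: ge_trans|exact: ge_anti|].
apply: perm_trans (perm_count_undup s).
have -> : [seq nseq (mup x p) x | x <- rootsR p] =
          [seq nseq (count_mem x s) x | x <- rootsR p].
  by apply: eq_map => x; rewrite mup_prod_XsubC.
apply: perm_flatten; apply: perm_map; apply: uniq_perm.
- exact: uniq_roots.
- exact: undup_uniq.
- move=> x; rewrite mem_undup -(root_prod_XsubC s).
  by have := roots_on_rootsR p0 x; rewrite in_itv => <-.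
Qed.

Lemma dotv_orthomx n (Q : 'M[R]_n) (x : 'rV[R]_n) : Q *m Q^T = 1%:M ->
  dotv (x *m Q) (x *m Q) = dotv x x.
Proof. by move=> QQ; rewrite dotv_mull -mulmxA QQ mulmx1. Qed.

Lemma quadform_diag n (Q : 'M[R]_n) (D x : 'rV[R]_n) :
  (x *m (Q^T *m diag_mx D *m Q) *m x^T) 0 0 =
  \sum_i D 0 i * (x *m Q^T) 0 i ^+ 2.
Proof.
rewrite -!mulmxA -[Q *m x^T]trmxK trmx_mul trmxK !mulmxA mul_mx_diag mxE.
by apply: eq_bigr => i _; rewrite !mxE; ring.
Qed.

Lemma orthomx_row n (Q : 'M[R]_n) i : Q *m Q^T = 1%:M ->
  row i Q *m Q^T = delta_mx 0 i.
Proof. by move=> QQ; rewrite -row_mul QQ rowE mulmx1. Qed.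

Lemma quadform_row n (Q : 'M[R]_n) (D : 'rV[R]_n) i : Q *m Q^T = 1%:M ->
  (row i Q *m (Q^T *m diag_mx D *m Q) *m (row i Q)^T) 0 0 = D 0 i.
Proof.
move=> QQ; rewrite quadform_diag orthomx_row// (bigD1 i)//= big1 => [|j ji].
  by rewrite !mxE !eqxx expr1n mulr1 addr0.
by rewrite !mxE (negPf ji) andbF expr0n mulr0.
Qed.

(** [xget] meets its specification once a witness exists: here the entrywise root of the spectrum,
    which is nonnegative because [D 0 i] is the value of the form at row i of [Q]. *)
Lemma sqrtmxP n (M : 'M[R]_n) : is_psd M ->
  is_psd (sqrtmx M) /\ sqrtmx M *m sqrtmx M = M.
Proof.
move=> [Msym Mpos].
apply: (@xgetPex _ 0 [set B : 'M[R]_n | is_psd B /\ B *m B = M]).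
have [Q [D [QQ ME]]] := symmetric_spectral Msym.
have D0 i : 0 <= D 0 i by rewrite -(quadform_row D i QQ) -ME.
exists (Q^T *m diag_mx (map_mx Num.sqrt D) *m Q); split; first split.
- by rewrite !trmx_mul trmxK tr_diag_mx mulmxA.
- move=> x; rewrite quadform_diag; apply: sumr_ge0 => i _.
  by rewrite mxE mulr_ge0// ?sqrtr_ge0 ?sqr_ge0.
- rewrite -!mulmxA (mulmxA Q) QQ mul1mx ME !mulmxA; congr (_ *m _).
  rewrite -mulmxA; congr (_ *m _); rewrite mul_mx_diag.
  apply/matrixP => i j; rewrite !mxE; case: (eqVneq i j) => [->|_].
    by rewrite -expr2 sqr_sqrtr.
  by rewrite mul0r.
Qed.

Lemma psd_gram N n (A : 'M[R]_(N, n)) : is_psd (A^T *m A).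
Proof.
split=> [|x]; first by rewrite trmx_mul trmxK.
by rewrite mulmxA -mulmxA -[A *m x^T]trmxK trmx_mul trmxK -dotvE dotvv_ge0.
Qed.

(** The interface through which the rest of the proof sees singular values. Diagonalizing the square
    root itself makes its sorted spectrum the singular values, and their squares the coefficients of
    the form; the rows of [Q] attain the extremes. *)
Lemma singular_value_bounds N n (A : 'M[R]_(N, n)) : (0 < n)%N ->
  [/\ 0 <= smin A <= smax A,
   forall x, smin A ^+ 2 * dotv x x <= dotv (x *m A^T) (x *m A^T) /\
             dotv (x *m A^T) (x *m A^T) <= smax A ^+ 2 * dotv x x,
   exists x, dotv x x = 1 /\ dotv (x *m A^T) (x *m A^T) = smin A ^+ 2 &
   exists x, dotv x x = 1 /\ dotv (x *m A^T) (x *m A^T) = smax A ^+ 2].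
Proof.
move=> n0; have [[Bsym Bpos] BB] := sqrtmxP (psd_gram A).
rewrite /smin /smax /singular_values.
have AB (x : 'rV_n) : dotv (x *m A^T) (x *m A^T) =
    (x *m (sqrtmx (A^T *m A) *m sqrtmx (A^T *m A)) *m x^T) 0 0.
  by rewrite BB dotvE trmx_mul trmxK !mulmxA.
move: (sqrtmx _) Bsym Bpos AB => B Bsym Bpos AB {BB}.
have [Q [D [QQ BE]]] := symmetric_spectral Bsym.
have D0 i : 0 <= D 0 i by rewrite -(quadform_row D i QQ) -BE.
pose E := map_mx (fun x => x ^+ 2) D.
have B2E : B *m B = Q^T *m diag_mx E *m Q.
  rewrite BE -!mulmxA (mulmxA Q) QQ mul1mx !mulmxA; congr (_ *m _).
  rewrite -mulmxA; congr (_ *m _); rewrite mul_mx_diag.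
  apply/matrixP => i j; rewrite !mxE; case: (eqVneq i j) => [->|_].
    by rewrite expr2.
  by rewrite mul0r.
have {}AB x : dotv (x *m A^T) (x *m A^T) = \sum_i E 0 i * (x *m Q^T) 0 i ^+ 2.
  by rewrite AB B2E quadform_diag.
have rowE i : dotv (row i Q *m A^T) (row i Q *m A^T) = D 0 i ^+ 2.
  by rewrite AB -quadform_diag quadform_row// mxE.
have row1 i : dotv (row i Q) (row i Q) = 1.
  have /matrixP/(_ i i) := QQ; rewrite !mxE eqxx -[RHS]/(1 : R) => <-.
  by apply: eq_bigr => j _; rewrite !mxE.
have normx (x : 'rV_n) : dotv x x = \sum_i (x *m Q^T) 0 i ^+ 2.
  rewrite -(@dotv_orthomx _ Q^T) ?trmxK; last exact: mulmx1C.
  by apply: eq_bigr => i _; rewrite expr2.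
rewrite BE eigenvalues_diag//.
set s := sort _ _.
have ssort : sorted >=%R s by apply: sort_sorted; exact: ge_total.
have ssize : size s = n by rewrite size_sort size_map size_enum_ord.
have sP k : (k < n)%N -> exists i, s`_k = D 0 i.
  move=> kn; have : s`_k \in s by rewrite mem_nth ?ssize.
  by rewrite mem_sort => /mapP[i _ ->]; exists i.
have sD i : s`_n.-1 <= D 0 i <= s`_0.
  have : D 0 i \in s by rewrite mem_sort map_f ?mem_enum.
  move=> /(nthP 0)[k]; rewrite ssize => kn <-.
  have hom := sorted_leq_nth (@ge_trans _ _) (@ge_refl _ _) 0 ssort.
  apply/andP; split; apply: hom; rewrite ?inE ?ssize//.
  - by rewrite prednK.
  - by rewrite -ltnS prednK.
have [imin sminE] := sP n.-1 (ltac:(by rewrite prednK)).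
have [imax smaxE] := sP 0%N n0.
split.
- by rewrite sminE D0/= -sminE smaxE (andP (sD _)).1.
- move=> x; rewrite AB normx !mulr_sumr; split; apply: ler_sum => i _;
    rewrite ler_wpM2r ?sqr_ge0// mxE ler_sqr ?nnegrE ?D0 ?sminE ?smaxE//.
  + by rewrite -sminE; case/andP: (sD i).
  + by rewrite -smaxE; case/andP: (sD i).
- by exists (row imin Q); rewrite row1 rowE sminE.
- by exists (row imax Q); rewrite row1 rowE smaxE.
Qed.

End SingularValueBounds.

(** * A net of the sphere and its cardinality *)

Section Net.
Context {R : realType}.

Lemma dotv_sqr_sum n (x : 'rV[R]_n) : dotv x x = \sum_j x 0 j ^+ 2.
Proof. by apply: eq_bigr => j _; rewrite expr2. Qed.

(* The bound on the sphere at x is compared with the one at a net point y by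
   polarizing q(x) - q(y) = b(x - y, x + y) at the vectors 4(x - y) and
   (x + y)/4, so that the error is at most a quarter of the sup itself. *)
Lemma quadform_net n (G : 'M[R]_n) (S : set 'rV[R]_n) (eta : R) :
  G^T = G -> 0 <= eta ->
  (forall x, dotv x x = 1 -> exists y, [/\ S y, dotv y y <= 1 &
     dotv (x - y) (x - y) <= 64^-1]) ->
  (forall y, S y -> dotv y y <= 1 -> `|dotv (y *m G) y| <= eta) ->
  forall x, dotv x x = 1 -> `|dotv (x *m G) x| <= 2 * eta.
Proof.
move=> Gsym eta0 net Gnet; pose q x := dotv (x *m G) x; rewrite -/q in Gnet *.
pose E : set R := [set `|q x| | x in [set x | dotv x x = 1]].
(* Coordinates of a unit vector are at most 1 in absolute value, so the sum of the absolute entries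
   of [G] is a bound and [sup E] is a genuine supremum. *)
have Eub : has_ubound E.
  exists (\sum_i \sum_j `|G i j|) => _ [x /= x1 <-].
  have x_le1 j : `|x 0 j| <= 1.
    rewrite -(expr_le1 (n := 2))// real_normK ?num_real// -x1 dotv_sqr_sum.
    by rewrite (bigD1 j)//= lerDl; apply: sumr_ge0 => i _; exact: sqr_ge0.
  rewrite exchange_big/= (le_trans (ler_norm_sum _ _ _))//.
  apply: ler_sum => j _; rewrite mxE normrM -[leRHS]mulr1 ler_pM//.
  rewrite (le_trans (ler_norm_sum _ _ _))//; apply: ler_sum => i _.
  by rewrite normrM -[leRHS]mul1r ler_wpM2r.
have qsup (x : 'rV[R]_n) : `|q x| <= sup E * dotv x x.
  have [->|x0] := eqVneq x 0.
    by rewrite /q mul0mx -(scale0r (0 : 'rV[R]_n)) !dotvZl !mul0r normr0 mulr0.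
  have xx0 : 0 < dotv x x by rewrite dotvv_gt0.
  pose a := Num.sqrt (dotv x x).
  have a2 : a ^+ 2 = dotv x x by rewrite sqr_sqrtr// ltW.
  have a0 : a != 0 by rewrite gt_eqF// sqrtr_gt0.
  have qxE : q x = q (a^-1 *: x) * dotv x x.
    by rewrite /q -scalemxAl dotvZl dotvZr -a2; field.
  rewrite qxE normrM (gtr0_norm xx0) ler_wpM2r ?(ltW xx0)//.
  apply: sup_upper_bound; last first.
    by exists (a^-1 *: x) => //=; rewrite dotvZl dotvZr -a2; field.
  split=> //; exists `|q (a^-1 *: x)|.
  by exists (a^-1 *: x) => //=; rewrite dotvZl dotvZr -a2; field.
have sup0 (x : 'rV[R]_n) : dotv x x = 1 -> 0 <= sup E.
  by move=> x1; have := qsup x; rewrite x1 mulr1; exact: le_trans.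
have q_le (x : 'rV[R]_n) : dotv x x = 1 -> `|q x| <= eta + sup E / 4.
  move=> x1; have [y [Sy y1 xy]] := net x x1.
  have {}sup0 := sup0 x x1.
  pose u := 4 *: (x - y); pose v := 4^-1 *: (x + y).
  have qxE : q x = q y + (q (u + v) - q (u - v)) / 4.
    have bC w z : dotv (w *m G) z = dotv (z *m G) w.
      by rewrite dotv_mull Gsym dotvC.
    rewrite /q /u /v !(mulmxDl, mulmxBl, mulNmx, =^~ scalemxAl, dotvDl, dotvDr,
                       dotvNl, dotvNr, dotvZl, dotvZr) (bC y x); by field.
  (* By the parallelogram law the sum is 32 |x - y|^2 + |x + y|^2 / 8, at most 32/64 + 4/8: the
     scalings 4 and 1/4 balance the two halves. *)
  have uv : dotv (u + v) (u + v) + dotv (u - v) (u - v) <= 1.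
    have -> : dotv (u + v) (u + v) + dotv (u - v) (u - v) =
        32 * dotv (x - y) (x - y) +
        8^-1 * (2 * dotv x x + 2 * dotv y y - dotv (x - y) (x - y)).
      by rewrite /u /v !(dotvDl, dotvDr, dotvNl, dotvNr, dotvZl, dotvZr);
        field.
    have := dotvv_ge0 (x - y); rewrite x1; lra.
  rewrite qxE (le_trans (ler_normD _ _))// lerD// ?Gnet//.
  rewrite normrM (ger0_norm (x := 4^-1))// ler_wpM2r//.
  rewrite (le_trans (ler_normB _ _))// (le_trans (lerD (qsup _) (qsup _)))//.
  by rewrite -mulrDr -[leRHS]mulr1 ler_wpM2l.
move=> x x1; have {}sup0 := sup0 x x1.
(* Solving gives sup E at most 4/3 eta, which leaves room in the factor 2. *)
have : sup E <= eta + sup E / 4.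
  apply: ge_sup; first by exists `|q x|; exists x.
  by move=> _ [z /= z1 <-]; exact: q_le.
have := q_le x x1; lra.
Qed.

(** Magnitudes and signs of integer coordinates, as a finite type so that the union bound is a
    finite sum. Zero has two codes, which merely enlarges the count. *)
Definition net_index n := {ffun 'I_n -> 'I_(64 * n).+1 * bool}.

Definition net_point n (z : net_index n) : 'rV[R]_n :=
  \row_j ((-1) ^+ (z j).2 * (z j).1%:R / (8 * Num.sqrt n%:R)).

(** All indices together number (2 (64 n + 1))^n, whose base grows with n; this l1 constraint brings
    the count down to a constant to the power n. *)
Definition small_index n (z : net_index n) := (\sum_j (z j).1 <= 64 * n)%N.

(** Rounding coordinates towards 0 on the grid does not increase the norm and moves each of the n
    coordinates by at most 1 / (8 sqrt n), hence a squared distance at most 1/64. *)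
Lemma net_pointP n (x : 'rV[R]_n) : dotv x x = 1 ->
  exists z, [/\ small_index z, dotv (net_point z) (net_point z) <= 1 &
    dotv (x - net_point z) (x - net_point z) <= 64^-1].
Proof.
move=> x1; have n0 : (0 < n)%N.
  by case: n x x1 => // x; rewrite /dotv big_ord0 => /esym/eqP; rewrite oner_eq0.
pose a : R := 8 * Num.sqrt n%:R.
have a2 : a ^+ 2 = 64 * n%:R by rewrite exprMn sqr_sqrtr//; ring.
have a0 : 0 < a by rewrite mulr_gt0// sqrtr_gt0 ltr0n.
pose k j : nat := Num.truncn (a * `|x 0 j|).
have kP j : (k j)%:R <= a * `|x 0 j| < (k j).+1%:R.
  by apply: truncn_itv; rewrite mulr_ge0// ltW.
(* A natural number is at most its square, so the l1 sum is bounded by the squared length [a ^+ 2]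
   of the scaled vector. *)
have ksum : (\sum_j k j <= 64 * n)%N.
  rewrite -(ler_nat R) natr_sum natrM -a2 -[leRHS]mulr1.
  rewrite -[X in _ <= _ * X]x1 dotv_sqr_sum.
  rewrite mulr_sumr; apply: ler_sum => j _.
  rewrite -[x 0 j ^+ 2]real_normK ?num_real// -exprMn.
  have /andP[kx _] := kP j; apply: le_trans (_ : (k j)%:R ^+ 2 <= _).
    by rewrite -natrX ler_nat; case: (k j) => // m; rewrite leq_pmulr.
  by rewrite ler_sqr ?nnegrE// mulr_ge0// ltW.
have kB j : (k j < (64 * n).+1)%N.
  by rewrite ltnS (leq_trans _ ksum)// (bigD1 j)//= leq_addr.
pose z : net_index n := [ffun j => (Ordinal (kB j), x 0 j < 0)].
have xE j : x 0 j = (-1) ^+ (x 0 j < 0)%R * `|x 0 j|.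
  by rewrite -realEsign ?num_real.
have zE j : net_point z 0 j = (-1) ^+ (x 0 j < 0)%R * ((k j)%:R / a).
  by rewrite !mxE ffunE/= mulrA.
exists z; split.
- by rewrite /small_index; under eq_bigr do rewrite ffunE/=.
- rewrite -x1 !dotv_sqr_sum; apply: ler_sum => j _.
  rewrite zE exprMn sqrr_sign mul1r -[x 0 j ^+ 2]real_normK ?num_real//.
  have /andP[kx _] := kP j.
  by rewrite ler_sqr ?nnegrE ?divr_ge0 ?(ltW a0)// ler_pdivrMr// mulrC.
- rewrite dotv_sqr_sum.
  apply: le_trans (_ : \sum_(j < n) (64 * n%:R)^-1 <= _); last first.
    rewrite sumr_const card_ord -[_ *+ n]mulr_natr invfM -mulrA.
    by rewrite mulVf ?mulr1// pnatr_eq0 -lt0n.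
  apply: ler_sum => j _; rewrite mxE [in X in _ + X]mxE zE {1}xE -mulrBr.
  have /andP[kx xk] := kP j; rewrite -a2 exprMn sqrr_sign mul1r.
  have -> : `|x 0 j| - (k j)%:R / a = (a * `|x 0 j| - (k j)%:R) / a.
    by field; rewrite gt_eqF.
  rewrite expr_div_n -[leRHS]mul1r ler_wpM2r ?invr_ge0 ?sqr_ge0//.
  by rewrite expr_le1// ?subr_ge0// lerBlDl -natr1 in xk *; exact: ltW.
Qed.

(* Each index is given the weight 2^(64 n - sum of its components), which is
   at least 1 on small indices and sums to a product over the coordinates. *)
Lemma sum1_small_index n :
  \sum_(z : net_index n | small_index z) 1 <= ((4 * 2 ^+ 64) ^+ n : R).
Proof.
pose w (z : net_index n) : R := (2 ^+ 64) ^+ n * \prod_j 2^-1 ^+ (z j).1.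
have w0 z : 0 <= w z.
  by rewrite mulr_ge0 ?exprn_ge0// prodr_ge0// => j _; rewrite exprn_ge0.
apply: le_trans (_ : \sum_z w z <= _).
  rewrite big_mkcond/=; apply: ler_sum => z _.
  case: ifPn => [|_]; last exact: w0.
  rewrite /small_index /w => zs.
  rewrite prodrXr exprVn -exprM -[leLHS](@mulfV _ (2 ^+ (64 * n))).
    by rewrite ler_wpM2l ?exprn_ge0// lef_pV2 ?posrE ?exprn_gt0//
      ler_weXn2l// ler1n.
  by rewrite expf_neq0// pnatr_eq0.
rewrite -mulr_sumr.
rewrite -(bigA_distr_bigA (fun _ (kb : 'I_(64 * n).+1 * bool) => 2^-1 ^+ kb.1)).
rewrite prodr_const card_ord -exprMn; apply: lerXn2r.
- by rewrite nnegrE mulr_ge0 ?exprn_ge0// sumr_ge0// => j _; rewrite exprn_ge0.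
- by rewrite nnegrE mulr_ge0 ?exprn_ge0.
(* Per coordinate the two signs give a factor 2 and the geometric series of ratio 1/2 another 2,
   whence the 4. *)
- rewrite mulrC ler_wpM2r ?exprn_ge0//.
  rewrite -(pair_bigA _ (fun (k : 'I_(64 * n).+1) (b : bool) => 2^-1 ^+ k))/=.
  under eq_bigr do rewrite sumr_const card_bool.
  rewrite sumrMnl mulr2n.
  have := @geometric_le_lim R (64 * n).+1 1 2^-1 ler01.
  rewrite invr_gt0 ger0_norm// invf_lt1// ltr0n ltr1n => /(_ isT isT).
  rewrite -exprn_geometric /series/= big_mkord.
  have -> : 1 / (1 - 2^-1) = 2 :> R by field.
  lra.
Qed.

End Net.

(** * Expectations of products of independent variables *)

Section IndependentProducts.
Import HBNNSimple.
Context {d : measure_display} {T : measurableType d} {R : realType}.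
Variable P : probability T R.

(** Approximation in [f]: the last hypothesis is the case of indicators, linearity gives simple
    functions, monotone convergence the rest. Finiteness of [c] lets it pass to the limit. *)
Lemma integral_mul_comp (G Y : T -> R) (f : R -> R) (c : \bar R) :
  measurable_fun setT G -> (forall w, 0 <= G w) ->
  measurable_fun setT Y -> measurable_fun setT f -> (forall y, 0 <= f y) ->
  c \is a fin_num ->
  (forall B, measurable B ->
     (\int[P]_w (G w * \1_B (Y w))%:E = c * P (Y @^-1` B))%E) ->
  (\int[P]_w (G w * f (Y w))%:E = c * \int[P]_w (f (Y w))%:E)%E.
Proof.
move=> mG G0 mY mf f0 cfin GY.
have indicY B w : \1_B (Y w) = \1_(Y @^-1` B) w :> R.
  by rewrite !indicE; congr (_%:R); apply/idP/idP; rewrite !inE.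
have mYB B : measurable B -> measurable (Y @^-1` B).
  by move=> mB; rewrite -[X in measurable X]setTI; exact: mY.
have sf (g : {nnsfun R >-> R}) :
    (\int[P]_w (G w * g (Y w))%:E = c * \int[P]_w (g (Y w))%:E)%E.
  pose s : seq R := finmap.enum_fset (fset_set (range g)).
  pose B r := g @^-1` [set r].
  have mB r : measurable (B r) by exact: measurable_sfunP.
  (* [Num.max r 0] is [r] on the range of the nonnegative [g]; it makes every summand nonnegative
     without tracking membership in [s]. *)
  have gE y : g y = \sum_(r <- s) Num.max r 0 * \1_(B r) y.
    have gs : g y \in s by rewrite [_ \in _]in_fset_set// inE; exists y.
    rewrite (bigD1_seq (g y) gs (finmap.fset_uniq _))/= big1 => [|r rg].
      by rewrite indicE mem_set// mulr1 addr0 max_l.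
    by rewrite indicE memNset ?mulr0//= => /esym/eqP; exact/negP.
  have mind r : measurable_fun setT (fun w => \1_(B r) (Y w) : R).
    by under eq_fun do rewrite indicY; apply: measurable_indic; exact: mYB.
  transitivity (\sum_(r <- s) (Num.max r 0)%:E *
                   \int[P]_w (G w * \1_(B r) (Y w))%:E)%E.
    under eq_integral do rewrite gE mulr_sumr -sumEFin.
    rewrite ge0_integral_sum//.
    - apply: eq_bigr => r _; rewrite -ge0_integralZl_EFin//.
      + by apply: eq_integral => w _; rewrite -EFinM mulrCA.
      + by move=> w _; rewrite lee_fin mulr_ge0.
      + by apply/measurable_EFinP; exact: measurable_funM.
      + by rewrite le_max lexx orbT.
    - move=> r; apply/measurable_EFinP; apply: measurable_funM => //.
      exact: measurable_funM.
    - by move=> r w _; rewrite lee_fin mulr_ge0// mulr_ge0// le_max lexx orbT.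
  transitivity (c * \sum_(r <- s) (Num.max r 0)%:E *
                   \int[P]_w (\1_(B r) (Y w))%:E)%E.
    rewrite ge0_sume_distrr => [|r _]; last first.
      rewrite mule_ge0 ?lee_fin ?le_max ?lexx ?orbT//.
      by apply: integral_ge0 => w _; rewrite lee_fin.
    apply: eq_bigr => r _; rewrite GY// muleCA; congr (_ * (_ * _))%E.
    under eq_integral do rewrite indicY.
    by rewrite integral_indic ?setIT//; exact: mYB.
  congr (_ * _)%E.
  under [RHS]eq_integral do rewrite gE -sumEFin.
  rewrite ge0_integral_sum//.
  - apply: eq_bigr => r _; rewrite -ge0_integralZl_EFin//.
    + exact/measurable_EFinP.
    + by rewrite le_max lexx orbT.
  - by move=> r; apply/measurable_EFinP; exact: measurable_funM.
  - by move=> r w _; rewrite lee_fin mulr_ge0// le_max lexx orbT.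
have mEf : measurable_fun setT (EFin \o f) by exact/measurable_EFinP.
have [g [gnd gcvg]] := approximation (@measurableT _ R) mEf (fun y _ => f0 y).
have mgY n : measurable_fun setT (fun w => g n (Y w)).
  exact: measurableT_comp.
have cvgY : (\int[P]_w (g n (Y w))%:E @[n --> \oo] -->
             \int[P]_w (f (Y w))%:E)%E.
  have -> : (\int[P]_w (f (Y w))%:E = \int[P]_w limn (fun n => (g n (Y w))%:E))%E.
    by apply: eq_integral => w _; apply/esym/cvg_lim => //; exact: gcvg.
  apply: (@cvg_monotone_convergence _ _ _ P setT measurableT
    (fun n w => (g n (Y w))%:E)).
  - by move=> n; exact/measurable_EFinP.
  - by move=> n w _; rewrite lee_fin.
  - by move=> w _ m n mn; rewrite lee_fin; exact/lefP/gnd.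
have cvgGY : (\int[P]_w (G w * g n (Y w))%:E @[n --> \oo] -->
             \int[P]_w (G w * f (Y w))%:E)%E.
  have -> : (\int[P]_w (G w * f (Y w))%:E =
             \int[P]_w limn (fun n => (G w * g n (Y w))%:E))%E.
    apply: eq_integral => w _; apply/esym/cvg_lim => //.
    exact: (cvgeZl (y := (G w)%:E) _ (gcvg (Y w) I)).
  apply: (@cvg_monotone_convergence _ _ _ P setT measurableT
    (fun n w => (G w * g n (Y w))%:E)).
  - by move=> n; apply/measurable_EFinP; exact: measurable_funM.
  - by move=> n w _; rewrite lee_fin mulr_ge0.
  - by move=> w _ m n mn; rewrite lee_fin ler_wpM2l//; exact/lefP/gnd.
have := cvg_lim (@ereal_hausdorff R) cvgGY; rewrite /= => <-.
by apply/cvg_lim => //; under eq_cvg do rewrite sf; exact: cvgeZl.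
Qed.

(** Starting from the product rule for events, indicators are replaced by functions one index at a
    time. The sets [B] stay quantified in the induction: varying the set at the current index
    supplies the hypothesis of [integral_mul_comp]. *)
Lemma independent_integral_prod N (Y : 'I_N -> T -> R) (f : 'I_N -> R -> R) :
  (forall i, measurable_fun setT (Y i)) ->
  (forall B : 'I_N -> set R, (forall i, measurable (B i)) ->
     P [set w | forall i, B i (Y i w)] = (\prod_(i < N) P (Y i @^-1` B i))%E) ->
  (forall i, measurable_fun setT (f i)) -> (forall i y, 0 <= f i y) ->
  (forall i, (\int[P]_w (f i (Y i w))%:E < +oo)%E) ->
  (\int[P]_w (\prod_(i < N) f i (Y i w))%:E =
   \prod_(i < N) \int[P]_w (f i (Y i w))%:E)%E.
Proof.
move=> mY indY mf f0 ffin.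
(* The factors of index at least k are indicators. *)
pose g k (B : 'I_N -> set R) (i : 'I_N) : R -> R :=
  if (i < k)%N then f i else \1_(B i).
suff main k (B : 'I_N -> set R) : (k <= N)%N -> (forall i, measurable (B i)) ->
    (\int[P]_w (\prod_(i < N) g k B i (Y i w))%:E =
     \prod_(i < N) \int[P]_w (g k B i (Y i w))%:E)%E.
  have gE i : g N (fun=> setT) i = f i by rewrite /g ltn_ord.
  transitivity (\int[P]_w (\prod_(i < N) g N (fun=> setT) i (Y i w))%:E)%E.
    by apply: eq_integral => w _; congr (_%:E); apply: eq_bigr => i _; rewrite gE.
  by rewrite main//; apply: eq_bigr => i _; rewrite gE.
have mYB i (C : set R) : measurable C -> measurable (Y i @^-1` C).
  by move=> mC; rewrite -[X in measurable X]setTI; exact: mY.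
have indicY i (C : set R) w : \1_C (Y i w) = \1_(Y i @^-1` C) w :> R.
  by rewrite !indicE; congr (_%:R); apply/idP/idP; rewrite !inE.
have int_indic i (C : set R) : measurable C ->
    (\int[P]_w (\1_C (Y i w))%:E = P (Y i @^-1` C))%E.
  move=> mC; under eq_integral do rewrite indicY.
  by rewrite integral_indic ?setIT//; exact: mYB.
elim: k B => [|k IH] B kN mB.
  have -> : (\prod_(i < N) \int[P]_w (g 0%N B i (Y i w))%:E =
             \prod_(i < N) P (Y i @^-1` B i))%E.
    by apply: eq_bigr => i _; exact: int_indic.
  rewrite -indY// -[in RHS](setIT [set w | _]) -integral_indic//; last first.
    rewrite (_ : [set w | _] = \bigcap_(i in setT) (Y i @^-1` B i)).
      by apply: fin_bigcap_measurable => // i _; exact: mYB.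
    by apply/seteqP; split => w /= H i; [move=> _; exact: H|exact: H].
  apply: eq_integral => w _; congr (_%:E).
  have [H|/existsNP[i nBi]] := pselect (forall i, B i (Y i w)).
    rewrite [RHS]indicE mem_set// big1// => i _.
    by rewrite /g/= indicE mem_set.
  rewrite [RHS]indicE memNset/=; last by move/(_ i).
  by rewrite (bigD1 i)//= {1}/g/= indicE memNset// mul0r.
pose j : 'I_N := Ordinal kN.
have gneq i C : i != j ->
    g k.+1 B i = g k (fun i => if i == j then C else B i) i.
  move=> ij; rewrite /g (negPf ij) ltnS leq_eqVlt.
  by have -> : (i == k :> nat) = false by apply/negbTE.
have g0 k' B' i y : 0 <= g k' B' i y by rewrite /g; case: ifP.
have mg k' B' i : (forall i, measurable (B' i)) ->
    measurable_fun setT (fun w => g k' B' i (Y i w)).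
  move=> mB'; rewrite /g; case: ifP => _; first exact: measurableT_comp.
  by under eq_fun do rewrite indicY; apply: measurable_indic; exact: mYB.
pose G w := \prod_(i < N | i != j) g k.+1 B i (Y i w).
pose c := (\prod_(i < N | i != j) \int[P]_w (g k.+1 B i (Y i w))%:E)%E.
rewrite (bigD1 j)//= -/c.
have -> : (\int[P]_w (\prod_(i < N) g k.+1 B i (Y i w))%:E =
           \int[P]_w (G w * f j (Y j w))%:E)%E.
  apply: eq_integral => w _; rewrite (bigD1 j)//= -/(G w) mulrC.
  by rewrite /g ltnS leqnn.
have -> : (\int[P]_w (g k.+1 B j (Y j w))%:E = \int[P]_w (f j (Y j w))%:E)%E.
  by rewrite /g ltnS leqnn.
rewrite muleC; apply: integral_mul_comp => //.
- rewrite /G; under eq_fun do rewrite -big_filter.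
  by apply: measurable_prod => i ij; exact: mg.
- by move=> w; apply: prodr_ge0.
- apply: prode_fin_num => i _; rewrite ge0_fin_numE; last first.
    by apply: integral_ge0 => w _; rewrite lee_fin.
  rewrite /g; case: ifP => _ //.
  rewrite int_indic// (le_lt_trans (probability_le1 _ _)) ?ltry//.
  exact: mYB.
- move=> C mC; pose B' i := if i == j then C else B i.
  have mB' i : measurable (B' i) by rewrite /B'; case: ifP.
  have gj : g k B' j = \1_C by rewrite /g /B' ltnn eqxx.
  have := IH B' (ltnW kN) mB'.
  rewrite [in X in _ = X -> _](bigD1 j)//= gj int_indic// muleC => {}IH.
  transitivity (\int[P]_w (\prod_(i < N) g k B' i (Y i w))%:E)%E.
    apply: eq_integral => w _; congr (_%:E).
    rewrite [RHS](bigD1 j)//= gj mulrC; congr (_ * _).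
    by apply: eq_bigr => i ij; rewrite (gneq i C).
  rewrite IH; congr (_ * _)%E.
  by apply: eq_bigr => i ij; rewrite (gneq i C).
Qed.

End IndependentProducts.

(** * Sub-gaussian moments and the exponential Markov inequality *)

Section SubgaussianMoments.
Context {d : measure_display} {T : measurableType d} {R : realType}.
Variable P : probability T R.

(** The exponent p = 2k in the supremum gives (K sqrt p)^p = (2 k K^2)^k; even exponents are the
    ones that occur as moments of Z^2. *)
Lemma psi2_norm_moment (Z : T -> R) (K : R) k : 0 <= K ->
  (psi2_norm P Z <= K%:E)%E -> (0 < k)%N ->
  (\int[P]_w (Z w ^+ (2 * k))%:E <= ((2 * k%:R * K ^+ 2) ^+ k)%:E)%E.
Proof.
move=> K0 ZK k0; pose p : R := (2 * k)%:R.
have p1 : 1 <= p by rewrite ler1n muln_gt0.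
have p0 : 0 < p by apply: lt_le_trans p1.
have pN0 : p != 0 by rewrite gt_eqF.
have N_le : ('N[P]_(p%:E)[EFin \o Z] <= (K * Num.sqrt p)%:E)%E.
  have : ((p `^ (- 2^-1))%:E * 'N[P]_(p%:E)[EFin \o Z] <= K%:E)%E.
    by apply: le_trans ZK; apply: ereal_sup_ubound; exists p.
  rewrite powRN powR12_sqrt ?(ltW p0)// => H.
  by rewrite mulrC EFinM -lee_pdivrMl ?sqrtr_gt0.
have -> : (\int[P]_w (Z w ^+ (2 * k))%:E =
           'N[P]_(p%:E)[EFin \o Z] `^ p)%E.
  rewrite powR_Lnorm//; apply: eq_integral => w _ /=.
  by rewrite powR_mulrn// -normrX ger0_norm// exprM exprn_ge0 ?sqr_ge0.
apply: (@le_trans _ _ ((K * Num.sqrt p)%:E `^ p)%E).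
  by apply: gt0_ler_poweR; rewrite ?(ltW p0)// in_itv/= ?Lnorm_ge0 ?leey//
    ?lee_fin ?andbT ?mulr_ge0// sqrtr_ge0.
rewrite poweR_EFin powR_mulrn ?mulr_ge0 ?sqrtr_ge0// exprM [(_ * _) ^+ 2]exprMn.
by rewrite sqr_sqrtr ?(ltW p0)// /p natrM mulrC.
Qed.

(** k^k / k! is a single term of the series of e^k. The factorial then cancels against the
    exponential series of Z^2. *)
Lemma exprn_le_fact (k : nat) : k%:R ^+ k <= expR 1 ^+ k * k`!%:R :> R.
Proof.
case: k => [|k]; first by rewrite !expr0 mulr1.
rewrite -ler_pdivrMr ?ltr0n ?fact_gt0// -expRM_natl mulr1.
by rewrite (le_trans _ (expR_ge1Dxn k _))// lerDr.
Qed.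

Lemma exp_markov (S : T -> R) (a : R) : measurable_fun setT S ->
  (P [set w | (a < S w)%R] <= (expR (- a))%:E * \int[P]_w (expR (S w))%:E)%E.
Proof.
move=> mS; have mE : measurable [set w | a < S w].
  rewrite -[X in measurable X]setTI.
  by have := mS measurableT _ (measurable_itv `]a, +oo[); rewrite preimage_itvoy.
have meS : measurable_fun setT (fun w => (expR (S w))%:E).
  by apply/measurable_EFinP; apply: measurableT_comp.
rewrite -ge0_integralZl_EFin ?expR_ge0//.
rewrite -[X in P X]setIT -integral_indic//; apply: ge0_le_integral => //.
- exact/measurable_EFinP/measurable_indic.
- exact: measurable_funeM.
- move=> w _; rewrite -EFinM -expRD lee_fin indicE.
  have [/set_mem/= aS|_] := boolP (w \in _); last exact: expR_ge0.
  by rewrite -[leLHS]expR0 ler_expR addrC subr_ge0 ltW.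
Qed.

End SubgaussianMoments.

(** * Exponential moments of a nonnegative variable of mean one *)

Section SquareMGF.
Context {d : measure_display} {T : measurableType d} {R : realType}.
Variables (P : probability T R) (W : T -> R) (L : R).
Hypotheses (mW : measurable_fun setT W) (W0 : forall w, 0 <= W w).
Hypothesis W1 : (\int[P]_w (W w)%:E = 1)%E.
Hypothesis Wk : forall k, (0 < k)%N ->
  (\int[P]_w (W w ^+ k)%:E <= (L ^+ k * k`!%:R)%:E)%E.

(** In the exponential series the first two terms are exactly 1 + l and the others are at most x^k
    with x = l L, a geometric tail of sum at most 2 x^2. The factor e^-l then removes the linear
    term. *)
Lemma mgf_ge0 l : 0 <= l -> l * L <= 2^-1 ->
  (\int[P]_w (expR (l * (W w - 1)))%:E <= (expR (2 * (l * L) ^+ 2))%:E)%E.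
Proof.
move=> l0 lL.
have L0 : 0 <= L.
  by have := Wk (isT : 0 < 1)%N; under eq_integral do rewrite expr1;
    rewrite W1 expr1 mulr1 lee_fin; apply: le_trans.
pose x := l * L; have x0 : 0 <= x by rewrite mulr_ge0.
pose a k := (\int[P]_w (exp_coeff (l * W w) k)%:E)%E.
have mc k : measurable_fun setT (fun w => exp_coeff (l * W w) k).
  rewrite /exp_coeff/=; apply: measurable_funM => //.
  by apply: measurable_funX; exact: measurable_funM.
have aE : (\int[P]_w (expR (l * W w))%:E = \sum_(0 <= k <oo) a k)%E.
  rewrite -integral_nneseries//.
  - apply: eq_integral => w _.
    rewrite /expR -EFin_lim; last exact: is_cvg_series_exp_coeff.
    congr (limn _); apply/funext => n /=.
    by rewrite /series/= sumEFin.
  - by move=> k; exact/measurable_EFinP.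
  - by move=> k w _; rewrite lee_fin exp_coeff_ge0// mulr_ge0.
have a0 : a 0%N = 1%E.
  rewrite /a /exp_coeff/=; under eq_integral do rewrite expr0 fact0 divr1.
  by rewrite integral_cst// mul1e; exact: probability_setT.
have akE k : a k = ((l ^+ k / k`!%:R)%:E * \int[P]_w (W w ^+ k)%:E)%E.
  rewrite -ge0_integralZl_EFin//.
  - by apply: eq_integral => w _; rewrite /exp_coeff/= -EFinM exprMn mulrAC.
  - by move=> w _; rewrite lee_fin exprn_ge0.
  - exact/measurable_EFinP/measurable_funX.
  - by rewrite divr_ge0// exprn_ge0.
have a1 : a 1%N = l%:E.
  rewrite akE; under eq_integral do rewrite expr1.
  by rewrite W1 mule1 expr1 divr1.
have ak k : (0 < k)%N -> (a k <= (x ^+ k)%:E)%E.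
  move=> k0; rewrite akE (le_trans (lee_wpmul2l _ (Wk k0)))//.
    by rewrite lee_fin divr_ge0// exprn_ge0.
  by rewrite -EFinM lee_fin exprMn -mulrA (mulrCA _^-1) mulVf ?mulr1.
(* The explicit remainder makes the induction close: its increment is x^2 2^-n, which dominates the
   new term x^(n+2). *)
have part n : (\sum_(0 <= k < n.+2) a k <=
               (1 + l + x ^+ 2 * (2 - 2 * 2^-1 ^+ n))%:E)%E.
  elim: n => [|n IH].
    by rewrite !big_nat_recr//= big_nil a0 a1 add0e expr0 mulr1 subrr mulr0 addr0.
  rewrite big_nat_recr//= (le_trans (leeD IH (ak n.+2 isT)))//.
  rewrite -EFinD lee_fin -addrA lerD2l -[n.+2]/(2 + n)%N exprD -mulrDr.
  rewrite ler_wpM2l ?sqr_ge0//.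
  have : x ^+ n <= 2^-1 ^+ n by rewrite lerXn2r ?nnegrE.
  by rewrite [X in _ -> _ <= _ - 2 * X]exprS; lra.
have int_le : (\int[P]_w (expR (l * W w))%:E <= (1 + l + 2 * x ^+ 2)%:E)%E.
  rewrite aE; apply: lime_le.
    apply: is_cvg_nneseries => k _ _; apply: integral_ge0 => w _.
    by rewrite lee_fin exp_coeff_ge0// mulr_ge0.
  exists 2%N => // -[|[|n]]//= _; rewrite (le_trans (part n))// lee_fin.
  by rewrite lerD2l mulrC ler_wpM2r ?sqr_ge0// gerBl mulr_ge0.
under eq_integral do rewrite mulrBr mulr1 expRD EFinM.
rewrite ge0_integralZr//; last first.
  apply/measurable_EFinP; apply: measurableT_comp => //.
  exact: measurable_funM.
rewrite (le_trans (lee_wpmul2r _ int_le)) ?lee_fin ?expR_ge0//.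
rewrite expRN ler_pdivrMr ?expR_gt0// -expRD.
by rewrite (le_trans _ (expR_ge1Dx _))// -addrA lerD2l addrC.
Qed.

(** For u >= 0, e^-u <= 1 / (1 + u) <= 1 - u + u^2, so the second moment suffices and [l] has no
    upper limit. *)
Lemma mgf_le0 l : 0 <= l ->
  (\int[P]_w (expR (- l * (W w - 1)))%:E <= (expR (2 * (l * L) ^+ 2))%:E)%E.
Proof.
move=> l0.
have expN u : 0 <= u -> expR (- u) + u <= 1 + u ^+ 2.
  move=> u0; have u1 : 0 < 1 + u by lra.
  have : expR (- u) <= (1 + u)^-1.
    by rewrite expRN lef_pV2 ?posrE ?expR_gt0// expR_ge1Dx.
  have : (1 + u)^-1 <= 1 - u + u ^+ 2.
    rewrite -[leLHS]mul1r ler_pdivrMr//.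
    have : 0 <= u ^+ 3 by rewrite exprn_ge0.
    by move=> ?; nra.
  lra.
have meW : measurable_fun setT (fun w => (expR (- (l * W w)))%:E).
  apply/measurable_EFinP; apply: measurableT_comp => //.
  by apply: measurableT_comp => //; exact: measurable_funM.
have W2 : (\int[P]_w (W w ^+ 2)%:E <= (2 * L ^+ 2)%:E)%E.
  by have := Wk (isT : 0 < 2)%N; rewrite mulrC.
(* Keeping [l], the mean of [l * W], on the left leaves nonnegative integrands on both sides. *)
have : (\int[P]_w (expR (- (l * W w)))%:E + l%:E <=
        (1 + 2 * (l * L) ^+ 2)%:E)%E.
  have -> : (l%:E = \int[P]_w (l * W w)%:E)%E.
    under eq_integral do rewrite EFinM.
    rewrite ge0_integralZl_EFin//; first by rewrite W1 mule1.
    - by move=> w _; rewrite lee_fin.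
    - exact/measurable_EFinP.
  rewrite -ge0_integralD//; last 2 first.
  - by move=> w _; rewrite lee_fin mulr_ge0.
  - by apply/measurable_EFinP; exact: measurable_funM.
  apply: (@le_trans _ _ (\int[P]_w (1 + (l ^+ 2)%:E * (W w ^+ 2)%:E))%E).
    apply: ge0_le_integral => //.
    - by move=> w _; rewrite adde_ge0// lee_fin ?expR_ge0// mulr_ge0.
    - apply: emeasurable_funD => //; apply/measurable_EFinP.
      exact: measurable_funM.
    - apply: emeasurable_funD => //; apply: measurable_funeM.
      exact/measurable_EFinP/measurable_funX.
    - move=> w _; rewrite -EFinM -!EFinD lee_fin -exprMn expN//.
      by rewrite mulr_ge0.
  rewrite ge0_integralD//; last 2 first.
  - by move=> w _; rewrite mule_ge0// lee_fin sqr_ge0.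
  - by apply: measurable_funeM; exact/measurable_EFinP/measurable_funX.
  have -> : (\int[P]_(w in setT) 1 = 1 :> \bar R)%E.
    by rewrite integral_cst// mul1e; exact: probability_setT.
  rewrite ge0_integralZl_EFin ?sqr_ge0//.
  - rewrite EFinD leeD2l// exprMn mulrCA [(_ ^+ 2 * _)%:E]EFinM.
    by rewrite lee_wpmul2l// lee_fin sqr_ge0.
  - by move=> w _; rewrite lee_fin sqr_ge0.
  - exact/measurable_EFinP/measurable_funX.
rewrite -leeBrDr// -EFinB => H.
have -> : (\int[P]_w (expR (- l * (W w - 1)))%:E =
           \int[P]_w ((expR (- (l * W w)))%:E * (expR l)%:E))%E.
  apply: eq_integral => w _; rewrite -EFinM -expRD; congr (expR _)%:E; ring.
rewrite ge0_integralZr//.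
rewrite (le_trans (lee_wpmul2r _ H)) ?lee_fin ?expR_ge0//.
rewrite -ler_pdivlMr ?expR_gt0// -expRN -expRD.
by rewrite (le_trans _ (expR_ge1Dx _))// addrA.
Qed.

End SquareMGF.

(** * Chernoff bound for sums of squares *)

Section Concentration.
Context {d : measure_display} {T : measurableType d} {R : realType}.
Variable P : probability T R.

(* The exponential moment of K-subgaussian squares is controlled through
   E Z^(2k) <= (2 k K^2)^k <= (2 e K^2)^k k!, whence the constant. *)
Definition subexp_const (K : R) := 2 * expR 1 * K ^+ 2.

Lemma sum_sqr_concentration N (Z : 'I_N -> T -> R) (K eta : R) :
  1 <= K -> 0 < eta ->
  (forall i, measurable_fun setT (Z i)) ->
  (forall B : 'I_N -> set R, (forall i, measurable (B i)) ->
     P [set w | forall i, B i (Z i w)] = (\prod_(i < N) P (Z i @^-1` B i))%E) ->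
  (forall i, (psi2_norm P (Z i) <= K%:E)%E) ->
  (forall i, (\int[P]_w (Z i w ^+ 2)%:E = 1)%E) ->
  (P [set w | (N%:R * eta < `|\sum_i Z i w ^+ 2 - N%:R|)%R] <=
   (2 * expR (- (N%:R * (eta * Num.min eta 1) /
                 (8 * subexp_const K ^+ 2))))%:E)%E.
Proof.
move=> K1 eta0 mZ indZ ZK Z1; pose L := subexp_const K.
have K0 : 0 <= K by apply: le_trans K1.
have L2 : 2 <= L.
  have e1 : 1 <= expR 1 :> R by rewrite -[leLHS]expR0 ler_expR.
  have K21 : 1 <= K ^+ 2 by rewrite expr_ge1.
  have := mulr_ege1 e1 K21.
  by rewrite /L /subexp_const -mulrA; lra.
have Wk i k : (0 < k)%N ->
    (\int[P]_w ((Z i w ^+ 2) ^+ k)%:E <= (L ^+ k * k`!%:R)%:E)%E.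
  move=> k0; under eq_integral do rewrite -exprM.
  rewrite (le_trans (psi2_norm_moment K0 (ZK i) k0))// lee_fin.
  have -> : L ^+ k * k`!%:R =
            (2 * K ^+ 2) ^+ k * (expR 1 ^+ k * k`!%:R) :> R.
    by rewrite /L /subexp_const mulrAC exprMn mulrA.
  rewrite mulrAC exprMn ler_wpM2l ?exprn_ge0 ?mulr_ge0 ?sqr_ge0//.
  exact: exprn_le_fact.
have mW i : measurable_fun setT (fun w => Z i w ^+ 2) by exact: measurable_funX.
have W0 i w : 0 <= Z i w ^+ 2 by exact: sqr_ge0.
pose m := Num.min eta 1.
have m0 : 0 < m by rewrite lt_min eta0 ltr01.
(* The exponent - l N eta + 2 N (l L)^2 is minimal at l = eta / (4 L^2); replacing [eta] by [m <= 1]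
   keeps l L below 1/2, since L >= 2. *)
pose l := m / (4 * L ^+ 2).
have l0 : 0 < l by rewrite divr_gt0// mulr_gt0// exprn_gt0//; lra.
have lL : l * L <= 2^-1.
  have -> : l * L = m / (4 * L) by rewrite /l; field; lra.
  rewrite ler_pdivrMr; last lra.
  have : m <= 1 by rewrite ge_min lexx orbT.
  lra.
(* Both tails at once: the sign of [s] selects the side, and the threshold is the same. *)
have tail s : s = l \/ s = - l ->
    (P [set w | (l * (N%:R * eta) < s * (\sum_i Z i w ^+ 2 - N%:R))%R] <=
     (expR (- (N%:R * (eta * m) / (8 * L ^+ 2))))%:E)%E.
  move=> sl.
  have mgf i : (\int[P]_w (expR (s * (Z i w ^+ 2 - 1)))%:E <=
                (expR (2 * (l * L) ^+ 2))%:E)%E.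
    case: sl => ->.
    - exact: (mgf_ge0 (mW i) (W0 i) (Z1 i) (Wk i) (ltW l0)).
    - exact: (mgf_le0 (mW i) (W0 i) (Z1 i) (Wk i) (ltW l0)).
  have mS : measurable_fun setT (fun w => s * (\sum_i Z i w ^+ 2 - N%:R)).
    apply: measurable_funM => //; apply: measurable_funB => //.
    exact: measurable_sum.
  rewrite (le_trans (exp_markov P _ mS))//.
  have -> : (\int[P]_w (expR (s * (\sum_i Z i w ^+ 2 - N%:R)))%:E =
             \int[P]_w (\prod_(i < N) expR (s * (Z i w ^+ 2 - 1)))%:E)%E.
    apply: eq_integral => w _; rewrite -expR_sum -mulr_sumr.
    congr (expR (_ * _))%:E; by rewrite sumrB sumr_const card_ord.
  rewrite (independent_integral_prod mZ indZ
             (f := fun _ z => expR (s * (z ^+ 2 - 1)))); last 3 first.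
  - move=> i; apply: measurableT_comp => //; apply: measurable_funM => //.
    by apply: measurable_funB => //; exact: measurable_funX.
  - by move=> i y; exact: expR_ge0.
  - by move=> i; rewrite (le_lt_trans (mgf i))// ltry.
  have prod_le : (\prod_(i < N) \int[P]_w (expR (s * (Z i w ^+ 2 - 1)))%:E <=
             (expR (N%:R * (2 * (l * L) ^+ 2)))%:E)%E.
    rewrite expRM_natl -[X in _ ^+ X]card_ord -prodr_const -prodEFin.
    suff /andP[] : (0 <= \prod_(i < N) \int[P]_w (expR (s * (Z i w ^+ 2 - 1)))%:E
        <= \prod_(i < N) (expR (2 * (l * L) ^+ 2))%:E)%E by [].
    apply: (big_ind2 (fun x y => (0 <= x <= y)%E)) => [|x y z t|i _].
    - by rewrite lee01 lexx.
    - by move=> /andP[x0 xy] /andP[z0 zt]; rewrite mule_ge0// lee_pmul.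
    - rewrite mgf andbT.
      by apply: integral_ge0 => w _; rewrite lee_fin expR_ge0.
  rewrite (le_trans (lee_wpmul2l _ prod_le)) ?lee_fin ?expR_ge0//.
  rewrite -expRD ler_expR.
  have : m ^+ 2 <= eta * m by rewrite expr2 ler_wpM2r ?(ltW m0)// ge_min lexx.
  have L20 : 0 < 8 * L ^+ 2 by rewrite mulr_gt0// exprn_gt0//; lra.
  move=> mm.
  have -> : - (l * (N%:R * eta)) + N%:R * (2 * (l * L) ^+ 2) =
            N%:R * (m ^+ 2 - 2 * (eta * m)) / (8 * L ^+ 2).
    by rewrite /l; field; lra.
  rewrite -[leRHS]mulNr -[X in _ <= X / _]mulrN ler_wpM2r ?invr_ge0 ?(ltW L20)//.
  rewrite ler_wpM2l//; lra.
have mset s : measurable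
    [set w | (l * (N%:R * eta) < s * (\sum_i Z i w ^+ 2 - N%:R))%R].
  have mS : measurable_fun setT (fun w => s * (\sum_i Z i w ^+ 2 - N%:R)).
    apply: measurable_funM => //; apply: measurable_funB => //.
    exact: measurable_sum.
  rewrite -[X in measurable X]setTI.
  have := mS measurableT _ (measurable_itv `]l * (N%:R * eta), +oo[).
  by rewrite preimage_itvoy.
have mabs : measurable [set w | (N%:R * eta < `|\sum_i Z i w ^+ 2 - N%:R|)%R].
  have mS : measurable_fun setT (fun w => `|\sum_i Z i w ^+ 2 - N%:R|).
    apply: measurableT_comp => //; apply: measurable_funB => //.
    exact: measurable_sum.
  rewrite -[X in measurable X]setTI.
  have := mS measurableT _ (measurable_itv `]N%:R * eta, +oo[).
  by rewrite preimage_itvoy.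
rewrite -/L -/m [2 * expR _]mulr_natl mulr2n EFinD.
apply: le_trans (leeD (tail l (or_introl erefl)) (tail (- l) (or_intror erefl))).
apply: le_trans (measureU2 _ (mset _) (mset _)).
apply: le_measure; rewrite ?inE//; first exact: measurableU.
move=> w /=; rewrite ltr_normr => /orP[H|H]; [left|right] => /=.
- by rewrite ltr_pM2l.
- by rewrite mulNr -mulrN ltr_pM2l.
Qed.

End Concentration.

(** * Testing quadratic forms on rational vectors *)

Section QuadraticForms.
Context {R : realType}.

Lemma continuous_quadform n (G : 'M[R]_n) :
  continuous (fun x : 'rV[R]_n => dotv (x *m G) x).
Proof.
have -> : (fun x : 'rV[R]_n => dotv (x *m G) x) =
          (fun x => \sum_j \sum_i x 0 i * G i j * x 0 j).
  by apply/funext => x; apply: eq_bigr => j _; rewrite mxE mulr_suml.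
apply: continuous_big; first exact: add_continuous.
move=> j _; apply: continuous_big; first exact: add_continuous.
have cx k : continuous (fun x : 'rV[R]_n => x 0 k) by exact: coord_continuous.
move=> i _ x; apply: continuousM (cx j x).
exact: continuousM (cx i x) (@cst_continuous _ _ (G i j) x).
Qed.

(** By continuity a negative value persists on a ball, and balls are for the sup norm, so a rational
    vector in it is found coordinate by coordinate. *)
Lemma quadform_ge0_rat n (G : 'M[R]_n) :
  (forall y : 'rV[rat]_n, 0 <= dotv (map_mx ratr y *m G) (map_mx ratr y)) ->
  forall x, 0 <= dotv (x *m G) x.
Proof.
move=> H x; rewrite leNgt; apply/negP => x0.
have : \forall y \near x, dotv (y *m G) y < 0.
  exact: (@continuous_quadform n G x _ (lt_nbhsl x0)).
move=> /nbhs_ballP[e/= e0 xe].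
have rat_near j : exists q : rat, `|x 0 j - ratr q| < e.
  have [q] := @rat_in_itvoo R (x 0 j - e) (x 0 j + e) ltac:(lra).
  by rewrite in_itv/= => /andP[? ?]; exists q; rewrite ltr_norml; lra.
pose y : 'rV[rat]_n := \row_j xget 0 [set q : rat | `|x 0 j - ratr q| < e].
have : dotv (map_mx ratr y *m G) (map_mx ratr y) < 0.
  have := xe (map_mx ratr y); apply; split=> // i j; rewrite ord1 !mxE.
  exact: (@xgetPex _ 0 [set q : rat | `|x 0 j - ratr q| < e] (rat_near j)).
by rewrite ltNge H.
Qed.

End QuadraticForms.

(** * Projections of the rows and measurability of the event *)

Section RandomRows.
Context {d : measure_display} {T : measurableType d} {R : realType}.
Variable P : probability T R.

Lemma borel_preimage n (f : 'rV[R]_n -> R) (B : set R) :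
  continuous f -> measurable B -> borel (f @^-1` B).
Proof.
move=> cf mB.
pose V := g_sigma_algebraType (@open 'rV[R]_n).
have mf : measurable_fun [set: V] (f : V -> R).
  apply: (measurability _ (RGenOpens.measurableE R)).
  move=> _ [_ [a [b ->]] <-]; rewrite setTI; apply: sub_sigma_algebra.
  by move/continuousP : cf; apply; exact: interval_open.
by have := mf measurableT _ mB; rewrite setTI.
Qed.

Lemma continuous_dotv n (x : 'rV[R]_n) : continuous (fun u => dotv u x).
Proof.
apply: continuous_big; first exact: add_continuous.
move=> j _ u.
have cu k : continuous (fun u : 'rV[R]_n => u 0 k) by exact: coord_continuous.
exact: continuousM (cu j u) (@cst_continuous _ _ (x 0 j) u).
Qed.

Lemma measurable_dotv n (X : T -> 'rV[R]_n) (x : 'rV[R]_n) :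
  random_vector X -> measurable_fun setT (fun w => dotv (X w) x).
Proof.
move=> mX _ B mB; rewrite setTI.
exact: (mX _ (borel_preimage (@continuous_dotv n x) mB)).
Qed.

Lemma independent_dotv N n (X : 'I_N -> T -> 'rV[R]_n) (x : 'rV[R]_n) :
  independent_vectors P X ->
  forall B : 'I_N -> set R, (forall i, measurable (B i)) ->
    P [set w | forall i, B i (dotv (X i w) x)] =
    (\prod_(i < N) P ((fun w => dotv (X i w) x) @^-1` B i))%E.
Proof.
move=> indX B mB.
apply: (indX (fun i => (fun u => dotv u x) @^-1` B i)) => i.
exact: (borel_preimage (@continuous_dotv n x) (mB i)).
Qed.

Lemma isotropic_dotv n (X : T -> 'rV[R]_n) (x : 'rV[R]_n) :
  random_vector X -> isotropic P X ->
  (\int[P]_w (dotv (X w) x ^+ 2)%:E = (dotv x x)%:E)%E.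
Proof.
move=> mX isoX.
have isoE j k : (\int[P]_w (X w 0 j * X w 0 k)%:E = ((j == k)%:R)%:E)%E.
  have := isoX j k; rewrite unlock mxE => <-.
  by apply: eq_integral => w _; rewrite mxE big_ord1 mxE.
have mXj j : measurable_fun setT (fun w => X w 0 j).
  have := measurable_dotv (delta_mx 0 j) mX; congr measurable_fun.
  apply/funext => w; rewrite /dotv (bigD1 j)//= big1 => [|k kj].
    by rewrite mxE !eqxx mulr1 addr0.
  by rewrite mxE (negPf kj) andbF mulr0.
have mXX j k : measurable_fun setT (fun w => (X w 0 j * X w 0 k)%:E).
  by apply/measurable_EFinP; exact: measurable_funM.
have intsq j : P.-integrable setT (fun w => (X w 0 j * X w 0 j)%:E).
  apply/integrableP; split=> //.
  under eq_integral do rewrite gee0_abs ?lee_fin -?expr2 ?sqr_ge0//.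
  by under eq_integral do rewrite expr2; rewrite isoE eqxx ltry.
(* The products change sign, so linearity needs integrability: |ab| <= a^2 + b^2, and the squares
   have integral 1. *)
have intXX j k : P.-integrable setT (fun w => (X w 0 j * X w 0 k)%:E).
  apply: (le_integrable measurableT (mXX j k) _
            (integrableD measurableT (intsq j) (intsq k))) => w _ /=.
  rewrite lee_fin [leRHS]ger0_norm ?addr_ge0 -?expr2 ?sqr_ge0//.
  have := sqr_ge0 (X w 0 j - X w 0 k); have := sqr_ge0 (X w 0 j + X w 0 k).
  by rewrite ler_norml; move: (X w 0 j) (X w 0 k) => a b; nra.
have -> : (\int[P]_w (dotv (X w) x ^+ 2)%:E =
    \int[P]_w \sum_j \sum_k ((x 0 j * x 0 k)%:E * (X w 0 j * X w 0 k)%:E))%E.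
  apply: eq_integral => w _; rewrite expr2 mulr_suml -sumEFin.
  apply: eq_bigr => j _; rewrite mulr_sumr -sumEFin.
  by apply: eq_bigr => k _; rewrite -EFinM; congr (_%:E); ring.
rewrite integral_sum//; last first.
  move=> j; apply: integrable_sum => // k _; exact: integrableZl.
rewrite -sumEFin; apply: eq_bigr => j _.
rewrite integral_sum//; last by move=> k; exact: integrableZl.
under eq_bigr do rewrite integralZl// isoE -EFinM.
rewrite sumEFin (bigD1 j)//= eqxx mulr1 big1 ?addr0// => k kj.
by rewrite eq_sym (negPf kj) mulr0.
Qed.

Lemma dotv_mulmx_rows N n (A : 'M[R]_(N, n)) (x : 'rV[R]_n) :
  dotv (x *m A^T) (x *m A^T) = \sum_i dotv (row i A) x ^+ 2.
Proof.
rewrite dotv_sqr_sum; apply: eq_bigr => i _; congr (_ ^+ 2).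
by rewrite mxE; apply: eq_bigr => j _; rewrite !mxE mulrC.
Qed.

Variables (N n : nat) (A : T -> 'M[R]_(N, n)).
Hypothesis n0 : (0 < n)%N.
Hypothesis mA : forall i : 'I_N, random_vector (fun w => row i (A w)).

Lemma measurable_quadform (x : 'rV[R]_n) :
  measurable_fun setT (fun w => dotv (x *m (A w)^T) (x *m (A w)^T)).
Proof.
under eq_fun do rewrite dotv_mulmx_rows.
by apply: measurable_sum => i; apply: measurable_funX; exact: measurable_dotv.
Qed.

Lemma measurable_bigcap_rat (F : 'rV[rat]_n -> set T) :
  (forall y, measurable (F y)) -> measurable [set w | forall y, F y w].
Proof.
move=> mF.
have -> : [set w | forall y, F y w] = ~` \bigcup_y (~` F y).
  by rewrite setC_bigcup; apply/seteqP; split => w H y;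
    [move=> _; rewrite setCK; exact: H|have := H y I; rewrite setCK].
apply: measurableC; apply: countable_bigcupT_measurable => [|y].
  exact: countableP.
exact/measurableC/mF.
Qed.

Lemma quadform_scalar_sub_gram (b : R) (B : 'M[R]_(N, n)) (x : 'rV[R]_n) :
  dotv (x *m (b%:M - B^T *m B)) x =
  b * dotv x x - dotv (x *m B^T) (x *m B^T).
Proof.
rewrite mulmxBr dotvDl dotvNl mul_mx_scalar dotvZl mulmxA; congr (_ - _).
by rewrite [LHS]dotv_mull.
Qed.

(** Turns the condition on [smax] into countably many conditions polynomial in the entries, which
    gives measurability without studying how [sqrtmx] and [eigenvalues] depend on the matrix. *)
Lemma smax_le (b : R) (B : 'M[R]_(N, n)) : 0 <= b ->
  (smax B <= b) <-> (forall y : 'rV[rat]_n, let x := map_mx ratr y in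
    dotv (x *m B^T) (x *m B^T) <= b ^+ 2 * dotv x x).
Proof.
move=> b0; have [/andP[s0 s1] bounds _ [x [x1 xE]]] := singular_value_bounds B n0.
split=> [sb y /=|H].
  rewrite (le_trans (bounds _).2)// ler_wpM2r ?dotvv_ge0// lerXn2r ?nnegrE//.
  exact: le_trans s1.
have : 0 <= dotv (x *m ((b ^+ 2)%:M - B^T *m B)) x.
  apply: quadform_ge0_rat => y; rewrite quadform_scalar_sub_gram subr_ge0.
  exact: H.
rewrite quadform_scalar_sub_gram x1 xE mulr1 subr_ge0 ler_sqr ?nnegrE//.
exact: le_trans s1.
Qed.

Lemma le_smin (b : R) (B : 'M[R]_(N, n)) : 0 <= b ->
  (b <= smin B) <-> (forall y : 'rV[rat]_n, let x := map_mx ratr y in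
    b ^+ 2 * dotv x x <= dotv (x *m B^T) (x *m B^T)).
Proof.
move=> b0; have [/andP[s0 s1] bounds [x [x1 xE]] _] := singular_value_bounds B n0.
split=> [sb y /=|H].
  by rewrite (le_trans _ (bounds _).1)// ler_wpM2r ?dotvv_ge0// lerXn2r ?nnegrE.
have : 0 <= dotv (x *m - ((b ^+ 2)%:M - B^T *m B)) x.
  apply: quadform_ge0_rat => y.
  by rewrite mulmxN dotvNl quadform_scalar_sub_gram opprB subr_ge0; exact: H.
rewrite mulmxN dotvNl quadform_scalar_sub_gram opprB x1 xE mulr1 subr_ge0.
by rewrite ler_sqr ?nnegrE.
Qed.

Lemma measurable_smax_le (b : R) : 0 <= b ->
  measurable [set w | smax (A w) <= b].
Proof.
move=> b0.
rewrite (_ : [set w | _] = [set w | forall y : 'rV[rat]_n,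
    [set w | dotv (map_mx ratr y *m (A w)^T) (map_mx ratr y *m (A w)^T) <=
             b ^+ 2 * dotv (map_mx ratr y) (map_mx ratr y)] w]); last first.
  by apply/seteqP; split => w /=; [move/(smax_le _ b0)|move=> H; exact/smax_le].
apply: measurable_bigcap_rat => y; rewrite -[X in measurable X]setTI.
exact: measurable_fun_le (measurable_quadform _) (measurable_cst _).
Qed.

Lemma measurable_le_smin (b : R) : measurable [set w | b <= smin (A w)].
Proof.
(* The lower threshold of the theorem may be negative, where squaring is invalid; the event is then
   everything, as [smin] is nonnegative. *)
have [b0|b0] := leP 0 b; last first.
  rewrite (_ : [set w | _] = setT)//; apply/seteqP; split => // w _ /=.
  have [/andP[s0 _] _ _ _] := singular_value_bounds (A w) n0.
  exact: le_trans (ltW b0) s0.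
rewrite (_ : [set w | _] = [set w | forall y : 'rV[rat]_n,
    [set w | b ^+ 2 * dotv (map_mx ratr y) (map_mx ratr y) <=
       dotv (map_mx ratr y *m (A w)^T) (map_mx ratr y *m (A w)^T)] w]); last first.
  by apply/seteqP; split => w /=; [move/(le_smin _ b0)|move=> H; exact/le_smin].
apply: measurable_bigcap_rat => y; rewrite -[X in measurable X]setTI.
exact: measurable_fun_le (measurable_cst _) (measurable_quadform _).
Qed.

End RandomRows.

(** * Tail bound at a single vector *)

Section NetTail.
Context {d : measure_display} {T : measurableType d} {R : realType}.
Variables (P : probability T R) (N n : nat) (A : T -> 'M[R]_(N, n)) (K : R).
Hypothesis K1 : 1 <= K.
Hypothesis mA : forall i : 'I_N, random_vector (fun w => row i (A w)).
Hypothesis indA : independent_vectors P (fun (i : 'I_N) w => row i (A w)).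
Hypothesis isoA : forall i : 'I_N, isotropic P (fun w => row i (A w)).
Hypothesis psiA : forall i : 'I_N,
  (psi2_norm_vector P (fun w => row i (A w)) <= K%:E)%E.

(** Both sides scale with [dotv y y], so the event depends on the direction of [y] alone; the strict
    inequality makes it empty at [y = 0], which is a net point. *)
Definition deviates (eta : R) (y : 'rV[R]_n) : set T :=
  [set w | (N%:R * eta * dotv y y <
            `|dotv (y *m (A w)^T) (y *m (A w)^T) - N%:R * dotv y y|)%R].

Lemma measurable_deviates eta y : measurable (deviates eta y).
Proof.
have mS : measurable_fun setT
    (fun w => `|dotv (y *m (A w)^T) (y *m (A w)^T) - N%:R * dotv y y|).
  apply: measurableT_comp => //; apply: measurable_funB => //.
  exact: measurable_quadform.
rewrite -[X in measurable X]setTI.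
have := mS measurableT _ (measurable_itv `]N%:R * eta * dotv y y, +oo[).
by rewrite preimage_itvoy.
Qed.

Lemma deviates_prob eta y : 0 < eta ->
  (P (deviates eta y) <=
   (2 * expR (- (N%:R * (eta * Num.min eta 1) /
                 (8 * subexp_const K ^+ 2))))%:E)%E.
Proof.
move=> eta0; have [->|y0] := eqVneq y 0.
  rewrite (_ : deviates eta 0 = set0) ?measure0 ?lee_fin ?mulr_ge0 ?expR_ge0//.
  apply/seteqP; split => // w; rewrite /deviates/= mul0mx.
  have dotv0 m : dotv (0 : 'rV[R]_m) 0 = 0 by apply/eqP; rewrite dotvv_eq0.
  by rewrite !dotv0 !mulr0 subrr normr0 ltxx.
have yy0 : 0 < dotv y y by rewrite dotvv_gt0.
pose a := Num.sqrt (dotv y y); pose x := a^-1 *: y.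
have a2 : a ^+ 2 = dotv y y by rewrite sqr_sqrtr// ltW.
have a0 : a != 0 by rewrite gt_eqF// sqrtr_gt0.
have x1 : dotv x x = 1 by rewrite dotvZl dotvZr -a2; field.
have -> : deviates eta y = [set w | (N%:R * eta <
    `|\sum_(i < N) dotv (row i (A w)) x ^+ 2 - N%:R|)%R].
  apply: eq_set => w; rewrite -dotv_mulmx_rows -scalemxAl dotvZl dotvZr.
  have -> : a^-1 * (a^-1 * dotv (y *m (A w)^T) (y *m (A w)^T)) - N%:R =
    (dotv (y *m (A w)^T) (y *m (A w)^T) - N%:R * dotv y y) / dotv y y.
    by rewrite -a2; field.
  by rewrite normrM (gtr0_norm (x := _^-1)) ?invr_gt0// ltr_pdivlMr.
apply: sum_sqr_concentration => //.
- by move=> i; exact: measurable_dotv.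
- exact: independent_dotv.
- move=> i; apply: le_trans (psiA i); apply: ereal_sup_ubound.
  by exists x => //=; apply/norm2_eq1.
- by move=> i; rewrite isotropic_dotv// x1.
Qed.

End NetTail.

(** * From the net to the singular values *)

Section Deterministic.
Context {R : realType}.

(* For z >= 0, |z^2 - 1| <= max(delta, delta^2) forces |z - 1| <= delta; here
   z = s / r. *)
Lemma sqr_dist_le (r s delta : R) : 0 < r -> 0 <= s -> 0 <= delta ->
  `|s ^+ 2 - r ^+ 2| <= Num.max delta (delta ^+ 2) * r ^+ 2 ->
  r - delta * r <= s <= r + delta * r.
Proof.
move=> r0 s0 delta0; pose z := s / r.
have z0 : 0 <= z by rewrite divr_ge0// ltW.
have sE : s = z * r by rewrite divfK// gt_eqF.
have -> : s ^+ 2 - r ^+ 2 = (z ^+ 2 - 1) * r ^+ 2 by rewrite sE; ring.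
rewrite normrM [`|r ^+ 2|]ger0_norm ?sqr_ge0// ler_pM2r ?exprn_gt0// => zd.
suff /andP[z1 z2] : 1 - delta <= z <= 1 + delta.
  by rewrite sE; apply/andP; split; nra.
move: zd; rewrite ler_norml => /andP[zl zu].
have [d1|d1] := leP delta 1.
  have mx : Num.max delta (delta ^+ 2) = delta.
    by apply/max_idPl; rewrite expr2 ler_piMl.
  rewrite mx in zl zu; apply/andP; split; rewrite leNgt; apply/negP => H; nra.
(* For delta > 1 the lower bound is negative, and z^2 <= 1 + delta^2 <= (1 + delta)^2 gives the
   upper one. *)
have mx : Num.max delta (delta ^+ 2) = delta ^+ 2.
  by apply/max_idPr; rewrite expr2 ler_peMl// ltW.
by rewrite mx in zl zu; apply/andP; split; nra.
Qed.

(** [smin] and [smax] are attained at unit vectors, so the two-sided estimate on the sphere applies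
    to each of them separately. *)
Lemma net_good_bounds N n (B : 'M[R]_(N, n)) (delta : R) :
  (0 < N)%N -> (0 < n)%N -> 0 <= delta ->
  (forall z : net_index n, small_index z -> let y := net_point z in
     `|dotv (y *m B^T) (y *m B^T) - N%:R * dotv y y| <=
     N%:R * (Num.max delta (delta ^+ 2) / 2) * dotv y y) ->
  Num.sqrt N%:R - delta * Num.sqrt N%:R <= smin B /\
  smax B <= Num.sqrt N%:R + delta * Num.sqrt N%:R.
Proof.
move=> N0 n0 delta0 good; pose eps := Num.max delta (delta ^+ 2).
have eps0 : 0 <= eps by rewrite le_max delta0.
pose G : 'M[R]_n := - (N%:R%:M - B^T *m B).
have qE y : dotv (y *m G) y = dotv (y *m B^T) (y *m B^T) - N%:R * dotv y y.
  by rewrite mulmxN dotvNl quadform_scalar_sub_gram opprB.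
have Gsym : G^T = G.
  by rewrite /G raddfN/= raddfB/= tr_scalar_mx trmx_mul trmxK.
pose S : set 'rV[R]_n := [set net_point z | z in [set z | small_index z]].
have sphere x : dotv x x = 1 ->
    `|dotv (x *m B^T) (x *m B^T) - N%:R| <= eps * N%:R.
  move=> x1; have -> : eps * N%:R = 2 * (N%:R * (eps / 2)) by field.
  have -> : dotv (x *m B^T) (x *m B^T) - N%:R = dotv (x *m G) x.
    by rewrite qE x1 mulr1.
  apply: (@quadform_net _ _ G S) => //.
  - by rewrite mulr_ge0// divr_ge0.
  - move=> u u1; have [z [zs z1 uz]] := net_pointP u1.
    by exists (net_point z); split=> //; exists z.
  - move=> _ [z /= zs <-] y1; rewrite qE (le_trans (good z zs))//.
    by rewrite -[leRHS]mulr1 ler_wpM2l// mulr_ge0// divr_ge0.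
have [/andP[s0 s1] _ [x [x1 xE]] [x' [x'1 x'E]]] := singular_value_bounds B n0.
have rN : Num.sqrt N%:R ^+ 2 = N%:R :> R by rewrite sqr_sqrtr.
have r0 : 0 < Num.sqrt N%:R :> R by rewrite sqrtr_gt0 ltr0n.
split.
- have /andP[] // : Num.sqrt N%:R - delta * Num.sqrt N%:R <= smin B <=
    Num.sqrt N%:R + delta * Num.sqrt N%:R.
  by apply: sqr_dist_le => //; rewrite rN -xE; exact: sphere.
- have /andP[] // : Num.sqrt N%:R - delta * Num.sqrt N%:R <= smax B <=
    Num.sqrt N%:R + delta * Num.sqrt N%:R.
  apply: sqr_dist_le => //; first exact: le_trans s1.
  by rewrite rN -x'E; exact: sphere.
Qed.

End Deterministic.

(** * Choice of the constants and union bound *)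

Theorem theorem5p39 (R : realType) (K : R) :
  exists C c : R, [/\ 0 < C, 0 < c &
    forall (N n : nat) (d : measure_display) (T : measurableType d)
      (P : probability T R) (A : T -> 'M[R]_(N, n)),
    (0 < N)%N -> (0 < n)%N ->
    (forall i : 'I_N, random_vector (fun w => row i (A w))) ->
    independent_vectors P (fun (i : 'I_N) w => row i (A w)) ->
    (forall i : 'I_N, sub_gaussian_vector P (fun w => row i (A w))) ->
    (forall i : 'I_N, isotropic P (fun w => row i (A w))) ->
    \big[maxe/-oo%E]_(i < N) psi2_norm_vector P (fun w => row i (A w)) =
      K%:E ->
    forall t : R, 0 <= t ->
      ((1 - 2 * expR (- (c * t ^+ 2)))%:E <=
       P [set w | (Num.sqrt N%:R - C * Num.sqrt n%:R - t <= smin (A w) /\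
                   smin (A w) <= smax (A w) /\
                   smax (A w) <= Num.sqrt N%:R + C * Num.sqrt n%:R + t)%R])%E].
Proof.
(* [K] serves as an upper bound for the row norms, so it may be raised to 1; this yields the lower
   bound 2 on [subexp_const K'] used in the Chernoff step. *)
pose K' := Num.max K 1.
pose L2 := subexp_const K' ^+ 2.
have K'1 : 1 <= K' by rewrite le_max lexx orbT.
have L20 : 0 < L2.
  by rewrite exprn_gt0// mulr_gt0 ?exprn_gt0 ?mulr_gt0 ?expR_gt0//;
    apply: lt_le_trans K'1.
(* The 8 comes from the concentration bound; the further 4 from eta = eps / 2, which enters
   quadratically. *)
pose c := (32 * L2)^-1.
have c0 : 0 < c by rewrite invr_gt0 mulr_gt0.
pose g : R := 4 * 2 ^+ 64.
have g1 : 1 < g.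
  rewrite /g; have : 1 <= 2 ^+ 64 :> R by rewrite expr_ge1// ler1n.
  lra.
have lng : 0 < ln g by rewrite ln_gt0.
pose C := Num.sqrt (ln g / c).
have C2 : C ^+ 2 * c = ln g.
  by rewrite sqr_sqrtr ?divr_ge0 ?ltW// divfK// gt_eqF.
have C0 : 0 < C by rewrite sqrtr_gt0 divr_gt0.
exists C, c; split=> // N n d T P A N0 n0 mA indA _ isoA psiA t t0.
have psi_le i : (psi2_norm_vector P (fun w => row i (A w)) <= K'%:E)%E.
  apply: (@le_trans _ _ K%:E); last by rewrite lee_fin le_max lexx.
  by rewrite -psiA (bigD1 i)//= le_max lexx.
pose rN : R := Num.sqrt N%:R; pose rn : R := Num.sqrt n%:R.
have rN0 : 0 < rN by rewrite sqrtr_gt0 ltr0n.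
have rn0 : 0 < rn by rewrite sqrtr_gt0 ltr0n.
pose delta := (C * rn + t) / rN.
(* Positive even for t = 0, as the tail bound requires a positive [eta]. *)
have Cnt0 : 0 < C * rn + t by rewrite ltr_wpDr// mulr_gt0.
have delta0 : 0 < delta by rewrite divr_gt0.
have deltaN : delta * rN = C * rn + t by rewrite divfK// gt_eqF.
pose eps := Num.max delta (delta ^+ 2); pose eta := eps / 2.
have eps0 : 0 < eps by rewrite lt_max delta0.
have eta0 : 0 < eta by rewrite divr_gt0.
set E := [set w | _].
have EE : E = [set w | rN - C * rn - t <= smin (A w)] `&`
              [set w | smax (A w) <= rN + C * rn + t].
  apply/seteqP; split => w /=; first by move=> [? [_ ?]].
  move=> [lo hi]; split=> //; split=> //.
  by have [/andP[_ ->]] := singular_value_bounds (A w) n0.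
have mE : measurable E.
  rewrite EE; apply: measurableI; first exact: measurable_le_smin.
  by apply: measurable_smax_le => //; rewrite -addrA addr_ge0 ?ltW.
pose D z := deviates A eta (net_point z : 'rV[R]_n).
have mD z : measurable (D z) by exact: measurable_deviates.
have subE : ~` E `<=` \bigcup_(z in [set z | small_index z]) D z.
  apply: subsetCl => w /= nD; rewrite EE /=.
  have [|lo hi] := @net_good_bounds R N n (A w) delta N0 n0 (ltW delta0).
    move=> z zs /=; rewrite leNgt; apply/negP => yD; apply: nD.
    by exists z; [exact: zs|exact: yD].
  by move: lo hi; rewrite -/rN deltaN opprD !addrA.
have tail z : (P (D z) <= (2 * (g ^- n * expR (- (c * t ^+ 2))))%:E)%E.
  rewrite (le_trans (deviates_prob K'1 mA indA isoA psi_le _ eta0))//.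
  rewrite lee_fin ler_pM2l//.
  have -> : g ^- n = expR (- (n%:R * ln g)).
    by rewrite expRN expRM_natl lnK// posrE (lt_trans ltr01).
  rewrite -expRD ler_expR -opprD lerN2.
  (* This undoes the maximum in [eps]: equality for delta <= 1, while for delta > 1 the product is
     delta^4 / 4 or delta^2 / 2. *)
  have eta_ge : delta ^+ 2 / 4 <= eta * Num.min eta 1.
    rewrite /eta /eps; have [d1|d1] := leP delta 1.
      have -> : Num.max delta (delta ^+ 2) = delta.
        by apply/max_idPl; rewrite expr2 ler_piMl// ltW.
      have -> : Num.min (delta / 2) 1 = delta / 2 by apply/min_idPl; lra.
      by rewrite le_eqVlt; apply/orP; left; apply/eqP; field.
    have -> : Num.max delta (delta ^+ 2) = delta ^+ 2.
      by apply/max_idPr; rewrite expr2 ler_peMl// ltW.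
    have d2 : 1 <= delta ^+ 2 by rewrite expr_ge1// ltW.
    by move: (delta ^+ 2) d2 => D' d2; have [?|?] := leP (D' / 2) 1; nra.
  have NE : N%:R = rN ^+ 2 by rewrite sqr_sqrtr.
  have nE : n%:R = rn ^+ 2 by rewrite sqr_sqrtr.
  apply: (@le_trans _ _ (N%:R * (delta ^+ 2 / 4) / (8 * L2))); last first.
    have L80 : 0 <= (8 * L2)^-1 by apply/ltW; rewrite invr_gt0; apply: mulr_gt0.
    by apply: ler_wpM2r => //; apply: ler_wpM2l.
  have -> : N%:R * (delta ^+ 2 / 4) / (8 * L2) = c * (C * rn + t) ^+ 2.
    by rewrite -deltaN NE /c; field; rewrite gt_eqF.
  rewrite -C2 nE.
  have -> : rn ^+ 2 * (C ^+ 2 * c) + c * t ^+ 2 = c * ((C * rn) ^+ 2 + t ^+ 2).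
    by ring.
  rewrite ler_wpM2l ?(ltW c0)//.
  (* (u + t)^2 >= u^2 + t^2 separates the part that pays for the net from the part that gives the
     probability. *)
  have : 0 <= C * rn * t by rewrite !mulr_ge0// ltW.
  by move: (C * rn) => u ut; nra.
have PC : (P (~` E) <= (2 * expR (- (c * t ^+ 2)))%:E)%E.
  apply: (@le_trans _ _ (\sum_(z \in [set z | small_index z]) P (D z))%E).
    apply: content_sub_fsum => //; first exact: finite_finset.
    exact: measurableC.
  have := @bigfs _ _ _ _ (index_enum (net_index n)) (@small_index n)
    (fun z => P (D z)) (index_enum_uniq _) => <-; last first.
    by move=> z _; rewrite mem_index_enum.
  apply: (@le_trans _ _ (\sum_(z : net_index n | small_index z)
      (2 * (g ^- n * expR (- (c * t ^+ 2))))%:E)%E).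
    apply: lee_sum => z _; exact: tail.
  (* There are at most [g ^+ n] small indices, and the factor [g ^- n] cancels them. *)
  rewrite sumEFin lee_fin -[X in \sum_(_ | _) X]mulr1 -mulr_sumr.
  rewrite -mulrA ler_pM2l// mulrAC ler_piMl ?expR_ge0// mulrC.
  rewrite ler_pdivrMr ?mul1r ?exprn_gt0//.
    exact: sum1_small_index.
  exact: lt_trans g1.
rewrite -[E]setCK probability_setC; last exact: measurableC.
by rewrite EFinB leeB.
Qed.
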